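(* Fix $\alpha\in(0,2)$. For each $\omega=(\Gamma_j,\zeta_j)_{j\ge0}\in\Omega_1$ (that is, with $\lim_{j\to\infty}\Gamma_j/j=1$), the following statements hold $\mathbf P^\omega$-almost surely. (a) For each $k\in\mathbb Z$, $\varrho_k^\omega$ is finite. Moreover, $\sum_{k\in\mathbb Z}(1+k^2)^{-1}(\varrho_k^\omega)^2<\infty$. (b) $\Delta^\omega$ is a self-adjoint operator on the domain $\mathcal D^\omega=\{v\in\ell^2(\mathbb Z):\|\Delta^\omega v\|_2<\infty\}$.
   Context: On a probability space $(\Upsilon,\mathcal G,\mathbf P)$ let $(\Gamma_j)_{j\ge0}$ be the (increasing) arrival times of a unit rate Poisson process on $(0,\infty)$, $(\zeta_j)_{j\ge0}$ i.i.d. uniform on $[0,1/2]$, $(U_j)_{j\ge0}$ i.i.d. uniform on $[0,1]$, the three sequences being independent. Write $\omega=(\Gamma_j,\zeta_j)_{j\ge0}$, and let $\mathbf P^\omega$ be conditional probability given $\omega$ (only $(U_j)$ is random). For $k\in\mathbb Z$ let $\varrho_k^\omega=2\sum_{j=0}^\infty\Gamma_j^{-1/\alpha}\cos(2\pi(U_j+k\zeta_j))$ and $\Lambda^\omega=\mathrm{diag}((\varrho_k^\omega)_{k\in\mathbb Z})$ on $\ell^2(\mathbb Z)$. Let $\Pi$ be the orthogonal projection on $\ell^2(\mathbb Z)$ with entries $\Pi(k,l)=\langle e_k,\Pi e_l\rangle$ equal to $\frac12$ if $k=l$, $0$ if $k\ne l$ and $k-l$ is even, $-\frac{i}{\pi(k-l)}$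 if $k-l$ is odd ($i=\sqrt{-1}$); equivalently, under the Fourier transform $(\mathfrak Fv)(x)=\sum_nv_ne^{2\pi inx}$ it is multiplication by $\mathbf 1_{[0,1/2]}$. Put $\Delta^\omega=\Pi\Lambda^\omega\Pi$, acting coordinatewise by $(\Delta^\omega v)_k=\sum_{l\in\mathbb Z}\Pi(k,l)\varrho_l^\omega(\Pi v)_l$ for $v\in\ell^2(\mathbb Z)$ (these sums converge absolutely whenever (a) holds). *)

(* Defs.v *)
From HB Require Import structures.
From mathcomp Require Export all_boot all_order all_algebra.
From mathcomp Require Export all_classical all_reals all_analysis.
From mathcomp.real_closed Require Export complex.

Set Implicit Arguments.
Unset Strict Implicit.
Unset Printing Implicit Defensive.

Import Order.TTheory GRing.Theory Num.Theory.
Import numFieldNormedType.Exports.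

Local Open Scope classical_set_scope.
Local Open Scope ring_scope.

Section Probability.
Context {d : measure_display} {T : measurableType d} {R : realType}.
Variable P : probability T R.

Definition has_law (X : T -> R) (mu : set R -> \bar R) : Prop :=
  forall B : set R, measurable B -> P (X @^-1` B) = mu B.

Definition mutually_independent (X : nat -> T -> R) : Prop :=
  forall (s : seq nat) (B : nat -> set R), uniq s ->
    (forall j, measurable (B j)) ->
    P (\bigcap_(j in [set` s]) X j @^-1` B j) =
    (\prod_(j <- s) fine (P (X j @^-1` B j)))%:E.

Definition iid_with_law (X : nat -> T -> R) (mu : set R -> \bar R) : Prop :=
  mutually_independent X /\ forall j, has_law (X j) mu.

Definition cylinder (X : nat -> T -> R) (n : nat) (B : nat -> set R) : set T :=
  \bigcap_(j in `I_n) X j @^-1` B j.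

(* The cylinder events of a sequence are a pi-system generating its
   sigma-algebra, so this is independence of the three sigma-algebras. *)
Definition independent_sequences3 (X Y Z : nat -> T -> R) : Prop :=
  forall (n : nat) (A B C : nat -> set R),
    (forall j, measurable (A j)) -> (forall j, measurable (B j)) ->
    (forall j, measurable (C j)) ->
    P (cylinder X n A `&` cylinder Y n B `&` cylinder Z n C) =
    (P (cylinder X n A) * P (cylinder Y n B) * P (cylinder Z n C))%E.

Definition arrival_gap (Gamma : nat -> T -> R) (j : nat) : T -> R :=
  if j is i.+1 then Gamma i.+1 \- Gamma i else Gamma 0%N.

(* Increasing enumeration of the points of a rate one Poisson process on
   (0, +oo): the interarrival times are i.i.d. exponential of rate 1. *)
Definition unit_poisson_arrivals (Gamma : nat -> T -> R) : Prop :=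
  [/\ forall y, 0 < Gamma 0%N y,
      forall j y, Gamma j y < Gamma j.+1 y &
      iid_with_law (arrival_gap Gamma) (exponential_prob (1 : R))].

End Probability.

Lemma half_gt0 {R : realType} : (0 : R) < 2^-1.
Proof. by rewrite invr_gt0 ltr0n. Qed.

Definition model_hypotheses {d : measure_display} {T : measurableType d}
    {R : realType} (P : probability T R)
    (Gamma zeta U : nat -> {RV P >-> R}) : Prop :=
  [/\ unit_poisson_arrivals P Gamma,
      iid_with_law P zeta (uniform_prob (@half_gt0 R)),
      iid_with_law P U (uniform_prob (@ltr01 R)) &
      independent_sequences3 P Gamma zeta U].

Section Environment.
Context {R : realType}.

(* An environment is omega = (Gamma_j, zeta_j)_j. *)
Definition environment_at {T : Type} (Gamma zeta : nat -> T -> R) (y : T) :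
  nat -> R * R := fun j => (Gamma j y, zeta j y).

(* The quotient at j = 0 (division by 0) is irrelevant to the limit. *)
Definition Omega1 : set (nat -> R * R) :=
  [set omega | (omega j).1 / j%:R @[j --> \oo] --> (1 : R)].

Definition varrho_term (alpha : R) (omega : nat -> R * R) (u : nat -> R)
    (k : int) (j : nat) : R :=
  (omega j).1 `^ (- alpha^-1) * cos (2 * pi * (u j + k%:~R * (omega j).2)).

(* For alpha >= 1 the series converges only conditionally: its sum is the limit
   of the partial sums in increasing order of j. *)
Definition varrho_finite alpha omega u (k : int) : Prop :=
  cvgn (series (varrho_term alpha omega u k)).

Definition varrho alpha omega u (k : int) : R :=
  2 * limn (series (varrho_term alpha omega u k)).

(* [quenched_ae P U omega Q]: Q holds P^omega-almost surely. As U is independent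
   of the environment, conditionally on the environment being omega the U_j keep
   their law under P, so that P^omega is P with omega frozen. *)
Definition quenched_ae {d : measure_display} {T : measurableType d}
    (P : probability T R) (U : nat -> T -> R) (omega : nat -> R * R)
    (Q : (nat -> R * R) -> (nat -> R) -> Prop) : Prop :=
  {ae P, forall y, Q omega (fun j => U j y)}.

End Environment.

Section Operators.
Context {R : realType}.
Local Notation C := R[i].
Implicit Types (u v w z : int -> C) (rho : int -> R).

Definition sumZ_real (f : int -> R) : R :=
  fine (\esum_(k in [set: int]) (Num.max (f k) 0)%:E) -
  fine (\esum_(k in [set: int]) (Num.max (- f k) 0)%:E).

(* Sum over Z of an absolutely summable complex family (the only case in which
   it is meaningful). *)
Definition sumZ (f : int -> C) : C :=
  Complex (sumZ_real (fun k => complex.Re (f k)))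
          (sumZ_real (fun k => complex.Im (f k))).

Definition l2norm v : \bar R :=
  ((\esum_(k in [set: int]) (Normc.normc (v k) ^+ 2)%:E) `^ 2^-1)%E.

Definition ell2 : set (int -> C) := [set v | (l2norm v < +oo)%E].

Definition l2dot u v : C := sumZ (fun k => conjc (u k) * v k).

Definition seq_comb (a : C) u v : int -> C := fun k => a * u k + v k.

Definition linear_on (D : set (int -> C)) (A : (int -> C) -> int -> C) : Prop :=
  [/\ D (fun=> 0),
      forall a u v, D u -> D v -> D (seq_comb a u v) &
      forall a u v, D u -> D v -> A (seq_comb a u v) = seq_comb a (A u) (A v)].

Definition dense_in_ell2 (D : set (int -> C)) : Prop :=
  forall v, ell2 v -> forall e : R, 0 < e ->
  exists2 u, D u & (l2norm (fun k => v k - u k)%R < e%:E)%E.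

(* [adjoint_graph D A w z]: w is in the domain of the adjoint A^* of the
   operator A with domain D, and A^* w = z. *)
Definition adjoint_graph (D : set (int -> C)) (A : (int -> C) -> int -> C)
    w z : Prop :=
  [/\ ell2 w, ell2 z & forall v, D v -> l2dot w (A v) = l2dot z v].

Definition self_adjoint (D : set (int -> C)) (A : (int -> C) -> int -> C) :
    Prop :=
  [/\ D `<=` ell2,
      forall v, D v -> ell2 (A v),
      linear_on D A,
      dense_in_ell2 D &
      forall w z, adjoint_graph D A w z <-> D w /\ A w = z].

Definition Pi_entry (k l : int) : C :=
  if k == l then Complex 2^-1 0
  else if (2 %| k - l)%Z then 0
  else Complex 0 (- (pi * (k - l)%:~R)^-1).

Definition Pi_op v : int -> C := fun k => sumZ (fun l => Pi_entry k l * v l).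

Definition Lambda_op rho v : int -> C := fun k => Complex (rho k) 0 * v k.

Definition Delta_op rho v : int -> C := Pi_op (Lambda_op rho (Pi_op v)).

Definition Delta_dom rho : set (int -> C) :=
  [set v | ell2 v /\ (l2norm (Delta_op rho v) < +oo)%E].

End Operators.

(* Main.v *)
Require Import Defs.
From mathcomp Require Import measurable_realfun ring lra.
Set Implicit Arguments.
Unset Strict Implicit.
Unset Printing Implicit Defensive.
Import Order.TTheory GRing.Theory Num.Theory.
Import numFieldNormedType.Exports.
Local Open Scope classical_set_scope.
Local Open Scope ring_scope.

(** Write Pi = 1/2 + i H, where H is the convolution with the real odd kernel
    equal to -1/(pi n) at odd n and to 0 at even n.

    Convergence and summability.  With omega fixed, the k-th series is a sum of
    a_j cos (2 pi (U_j + c_j)) with deterministic a_j = Gamma_j^(-1/alpha) and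
    c_j = k zeta_j.  Since U_j is uniform and the U_j are pairwise independent,
    the terms are orthogonal in L^2(P) whatever the c_j ([mean_waveM]).  Because
    Gamma_j ~ j and alpha < 2, the sum of a_j^2 over the dyadic block
    [2^m, 2^(m+1)) decays geometrically in m ([amplitude_blocks]), so a dyadic
    chaining in the manner of Rademacher and Menshov ([chain_max],
    [mean_chain]) turns orthogonality into control of the largest partial sum
    inside each block.  This gives convergence together with a random majorant
    of varrho_k^2 whose mean is bounded uniformly in k ([majorant_cvg],
    [integral_majorant]).

    From the uniform bound on the means, Fatou's lemma yields more than the
    summability of varrho_k^2 / (1 + k^2): almost surely the averages
    sum_k varrho_k^2 N / (N^2 + k^2) are bounded along some sequence of N
    tending to infinity ([ae_tame]).  The summability alone would bound them
    only by a multiple of N.  The rest is deterministic.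

    Self-adjointness.  H is bounded on l^2, because the columns of its matrix
    are orthogonal and of equal norm ([hilbert_bounded]).  For v and w in the
    maximal domain, Lambda Pi v need not be square summable, and Pi cannot simply
    be moved to the other side of <w, Pi Lambda Pi v>.  One inserts the cutoff
    chi_N(k) = N^2 / (N^2 + k^2).  Its divided differences separate, so the
    kernel of the commutator of H and chi_N is at most 2 s_N(k) s_N(l) with
    s_N(k)^2 = N / (N^2 + k^2) ([commutator_le]).  Paired with s_N, a fixed
    vector of l^2 gives sums tending to 0 ([window_sum_cvg0]), whereas
    Lambda Pi v gives sums that stay bounded along the good sequence of N.
    Hence <w, Delta v> is the limit of
    sum_k chi_N(k) varrho_k conj((Pi w)_k) (Pi v)_k,
    an expression that is Hermitian in (v, w): Delta is symmetric
    ([comp_symmetric]).  Conversely every basis vector e_m is in the domain,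
    the m-th column of Pi being O(1/|k|), and testing an adjoint pair (w, z)
    against e_m gives z_m = (Delta w)_m ([l2dot_Delta_basis]), so the adjoint is
    Delta itself. *)

(** * Summation over the integers *)

Section SumsOverZ.
Context {R : realType}.
Implicit Types f g : int -> R.

(** The window of the n-th partial sum is [-n, n), since Negz i is -(i + 1). *)
Definition zseries f : R^nat := series (fun n : nat => f (Posz n) + f (Negz n)).
Definition zsummable f := exists M, forall n, zseries (fun k => `|f k|) n <= M.
Definition zsum f : R := limn (zseries f).

Definition zwin (n : nat) (k : int) : bool :=
  match k with Posz i => (i < n)%N | Negz i => (i < n)%N end.
Definition ztrunc n f : int -> R := fun k => if zwin n k then f k else 0.

Lemma zseriesS f n : zseries f n.+1 = zseries f n + (f (Posz n) + f (Negz n)).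
Proof. by rewrite /zseries seriesSr. Qed.

Lemma zseries0 f : zseries f 0 = 0.
Proof. by rewrite /zseries /series/= big_nil. Qed.

Lemma le_zseries f g n : (forall k, f k <= g k) -> zseries f n <= zseries g n.
Proof. by move=> fg; apply: ler_sum => i _; apply: lerD. Qed.

Lemma zseries_ge0 f n : (forall k, 0 <= f k) -> 0 <= zseries f n.
Proof. by move=> f0; apply: sumr_ge0 => i _; apply: addr_ge0. Qed.

Lemma zseriesD f g n :
  zseries (fun k => f k + g k) n = zseries f n + zseries g n.
Proof.
by rewrite /zseries /series/= -big_split/=; apply: eq_bigr => i _; rewrite addrACA.
Qed.

Lemma zseriesZ a f n : zseries (fun k => a * f k) n = a * zseries f n.
Proof.
by rewrite /zseries /series/= mulr_sumr; apply: eq_bigr => i _; rewrite mulrDr.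
Qed.

Lemma nondecreasing_zseries f : (forall k, 0 <= f k) ->
  nondecreasing_seq (zseries f).
Proof.
move=> f0; apply/nondecreasing_seqP => n.
by rewrite zseriesS lerDl addr_ge0.
Qed.

Lemma zsummable_le f g : (forall k, `|f k| <= g k) -> zsummable g -> zsummable f.
Proof.
move=> fg [M gM]; exists M => n; apply: le_trans (gM n).
by apply: le_zseries => k; rewrite (le_trans (fg k))// ler_norm.
Qed.

Lemma zsummable_norm f : zsummable f -> zsummable (fun k => `|f k|).
Proof. by move=> [M fM]; exists M => n; under eq_fun do rewrite normr_id. Qed.

Lemma zsummableD f g : zsummable f -> zsummable g ->
  zsummable (fun k => f k + g k).
Proof.
move=> [M fM] [N gN]; exists (M + N) => n.
apply: le_trans (lerD (fM n) (gN n)); rewrite -zseriesD.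
by apply: le_zseries => k; exact: ler_normD.
Qed.

Lemma zsummableZ a f : zsummable f -> zsummable (fun k => a * f k).
Proof.
move=> [M fM]; exists (`|a| * M) => n; under eq_fun do rewrite normrM.
by rewrite zseriesZ ler_wpM2l.
Qed.

Lemma zsummableN f : zsummable f -> zsummable (fun k => - f k).
Proof. by move=> [M fM]; exists M => n; under eq_fun do rewrite normrN. Qed.

Lemma zsummableB f g : zsummable f -> zsummable g ->
  zsummable (fun k => f k - g k).
Proof. by move=> sf sg; apply: zsummableD => //; exact: zsummableN. Qed.

Lemma ge0_zsummable f M : (forall k, 0 <= f k) ->
  (forall n, zseries f n <= M) -> zsummable f.
Proof.
by move=> f0 fM; exists M => n; under eq_fun do rewrite ger0_norm//.
Qed.

Lemma zsum_cvg f : zsummable f -> zseries f @ \oo --> zsum f.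
Proof.
move=> [M fM]; apply: normed_cvg; apply: nondecreasing_is_cvgn.
  by apply: nondecreasing_series => n _ _; exact: normr_ge0.
exists M => _ [n _ <-]; apply: le_trans (fM n); apply: ler_sum => i _.
exact: ler_normD.
Qed.

Lemma zsum_eq f l : zseries f @ \oo --> l -> zsum f = l.
Proof. by move=> fl; exact: cvg_lim. Qed.

Lemma zsumD f g : zsummable f -> zsummable g ->
  zsum (fun k => f k + g k) = zsum f + zsum g.
Proof.
move=> /zsum_cvg sf /zsum_cvg sg; apply: zsum_eq.
by rewrite (_ : zseries _ = zseries f + zseries g); [exact: cvgD|
  apply/funext => n; rewrite zseriesD].
Qed.

Lemma zsumZ a f : zsummable f -> zsum (fun k => a * f k) = a * zsum f.
Proof.
move=> /zsum_cvg sf; apply: zsum_eq.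
rewrite (_ : zseries _ = (fun n => a * zseries f n)).
  by apply: cvgM; [exact: cvg_cst|exact: sf].
by apply/funext => n; rewrite zseriesZ.
Qed.

Lemma zsumN f : zsummable f -> zsum (fun k => - f k) = - zsum f.
Proof.
move=> sf; rewrite -mulN1r -zsumZ//; congr zsum.
by apply/funext => k; rewrite mulN1r.
Qed.

Lemma zsumB f g : zsummable f -> zsummable g ->
  zsum (fun k => f k - g k) = zsum f - zsum g.
Proof. by move=> sf sg; rewrite zsumD ?zsumN//; exact: zsummableN. Qed.

Lemma ler_zsum f g : zsummable f -> zsummable g -> (forall k, f k <= g k) ->
  zsum f <= zsum g.
Proof.
move=> sf sg fg; apply: ler_lim; [exact/cvgP/zsum_cvg|exact/cvgP/zsum_cvg|].
by near=> n; exact: le_zseries.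
Unshelve. all: by end_near. Qed.

Lemma zsum_ge0 f : zsummable f -> (forall k, 0 <= f k) -> 0 <= zsum f.
Proof.
move=> sf f0; apply: limr_ge; first exact/cvgP/zsum_cvg.
by near=> n; exact: zseries_ge0.
Unshelve. all: by end_near. Qed.

Lemma zseries_le_zsum f n : zsummable f -> (forall k, 0 <= f k) ->
  zseries f n <= zsum f.
Proof.
move=> sf f0; apply: nondecreasing_cvgn_le; first exact: nondecreasing_zseries.
exact/cvgP/zsum_cvg.
Qed.

Lemma zsum_le f M : zsummable f -> (forall n, zseries f n <= M) -> zsum f <= M.
Proof.
move=> sf fM; apply: limr_le; first exact/cvgP/zsum_cvg.
by near=> n; exact: fM.
Unshelve. all: by end_near. Qed.

Lemma norm_zsum_le f g : (forall k, `|f k| <= g k) -> zsummable g ->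
  `|zsum f| <= zsum g.
Proof.
move=> fg sg; have sf := zsummable_le fg sg.
rewrite ler_norml -zsumN//; apply/andP; split; apply: ler_zsum => //.
- exact: zsummableN.
- by move=> k; rewrite lerNl (le_trans _ (fg k))// -normrN ler_norm.
- by move=> k; rewrite (le_trans _ (fg k))// ler_norm.
Qed.

Lemma zwin_exists (k : int) : exists n, zwin n k.
Proof. by case: k => i; exists i.+1 => /=. Qed.

Lemma le_zseries_term f n k : (forall k, 0 <= f k) -> zwin n k ->
  f k <= zseries f n.
Proof.
move=> f0; elim: n => [|n IH]; first by case: k.
rewrite zseriesS; have [/IH h _|nw] := boolP (zwin n k).
  by rewrite (le_trans h)// lerDl addr_ge0.
case: k nw {IH} => i /=; rewrite -leqNgt ltnS => ni ni';
  have -> : i = n by apply/eqP; rewrite eqn_leq ni ni'.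
- by rewrite addrCA lerDl addr_ge0// zseries_ge0.
- by rewrite addrA lerDr addr_ge0// zseries_ge0.
Qed.

Lemma ler_zsum_term f k : zsummable f -> (forall k, 0 <= f k) -> f k <= zsum f.
Proof.
move=> sf f0; have [n nk] := zwin_exists k.
exact: le_trans (le_zseries_term f0 nk) (zseries_le_zsum _ sf f0).
Qed.

Lemma zseries_trunc f m n : (m <= n)%N -> zseries (ztrunc m f) n = zseries f m.
Proof.
move=> mn; rewrite -(subnKC mn); elim: (n - m)%N => [|j IH].
  by rewrite addn0; apply: eq_big_nat => i /andP[_ im]; rewrite /ztrunc/= im.
by rewrite addnS zseriesS IH /ztrunc/= ltnNge leq_addr/= !addr0.
Qed.

Lemma eq_zseries f g n : (forall k, zwin n k -> f k = g k) ->
  zseries f n = zseries g n.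
Proof.
by move=> fg; apply: eq_big_nat => i /andP[_ im]; rewrite !fg.
Qed.

Lemma zsum_trunc m f : zsum (ztrunc m f) = zseries f m.
Proof.
apply: zsum_eq; apply/cvgrPdist_lt => e e0; near=> n.
rewrite zseries_trunc ?subrr ?normr0//.
by near: n; exact: nbhs_infty_ge.
Unshelve. all: by end_near. Qed.

Lemma zsummable_trunc m f : zsummable (ztrunc m f).
Proof.
exists (zseries (fun k => `|f k|) m) => n.
rewrite [X in zseries X n](_ : _ = ztrunc m (fun k => `|f k|)); last first.
  by apply/funext => k; rewrite /ztrunc; case: ifP => // _; rewrite normr0.
have [mn|/ltnW nm] := leqP m n; first by rewrite zseries_trunc.
apply: (@le_trans _ _ (zseries (fun k => `|f k|) n)); last first.
  by apply: nondecreasing_zseries => // k; exact: normr_ge0.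
by apply: le_zseries => k; rewrite /ztrunc; case: ifP.
Qed.

Lemma zsum_delta m f : zsummable (fun k => (k == m)%:R * f k) /\
  zsum (fun k => (k == m)%:R * f k) = f m.
Proof.
have [n nm] := zwin_exists m.
have -> : (fun k => (k == m)%:R * f k) = ztrunc n (fun k => (k == m)%:R * f k).
  apply/funext => k; rewrite /ztrunc; case: ifPn => // nk.
  by case: eqP => [km|_]; [rewrite km nm in nk|rewrite mul0r].
split; first exact: zsummable_trunc.
rewrite zsum_trunc; elim: n nm => [|n IH]; first by case: m.
rewrite zseriesS; have [/[dup] nm /IH -> _|nw nw'] := boolP (zwin n m).
  case: m nm {IH} => i /= im; rewrite ?gtn_eqF// /eq_op/= ?gtn_eqF//= ?eqE/=;
  by rewrite ?gtn_eqF// !mul0r !addr0.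
have -> : zseries (fun k => (k == m)%:R * f k) n = 0.
  rewrite /zseries /series/= big1_seq// => i; rewrite mem_index_iota => /andP[_ ni].
  rewrite (_ : (Posz i == m) = false); last by apply: contraNF nw => /eqP <-.
  rewrite (_ : (Negz i == m) = false); last by apply: contraNF nw => /eqP <-.
  by rewrite !mul0r addr0.
rewrite add0r; case: m nw nw' {IH} => i /=; rewrite -leqNgt ltnS => ni ni';
  have -> : i = n by apply/eqP; rewrite eqn_leq ni ni'.
- by rewrite eqxx mul1r /eq_op/= mul0r addr0.
- by rewrite eqxx mul1r /eq_op/= mul0r add0r.
Qed.


Lemma cvg_zseries (F : nat -> int -> R) f m :
  (forall k, F n k @[n --> \oo] --> f k) ->
  zseries (F n) m @[n --> \oo] --> zseries f m.
Proof.
move=> Ff; elim: m => [|m IH].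
  by under eq_fun do rewrite zseries0; rewrite zseries0; exact: cvg_cst.
under eq_fun do rewrite zseriesS; rewrite zseriesS.
by apply: cvgD => //; exact: cvgD.
Qed.

(** Outside a window all the sums are bounded, uniformly in n, by the tail of g;
    inside it there are finitely many terms. *)
Lemma zsum_dominated_cvg (F : nat -> int -> R) f g : zsummable g ->
  (forall n k, `|F n k| <= g k) -> (forall k, F n k @[n --> \oo] --> f k) ->
  zsum (F n) @[n --> \oo] --> zsum f.
Proof.
move=> sg Fg Ff.
have sF n : zsummable (F n) by exact: zsummable_le (Fg n) sg.
have fg k : `|f k| <= g k.
  rewrite -(cvg_lim _ (cvg_norm (Ff k)))//; apply: limr_le.
    by apply: is_cvg_norm; apply/cvgP/Ff.
  by near=> n; exact: Fg.
have sf : zsummable f by exact: zsummable_le sg.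
have g0 k : 0 <= g k by exact: le_trans (normr_ge0 _) (fg k).
have tail m h : (forall k, `|h k| <= g k) ->
    `|zsum h - zseries h m| <= zsum g - zseries g m.
  move=> hg; have sh := zsummable_le hg sg.
  rewrite -!zsum_trunc -!zsumB//; try exact: zsummable_trunc.
  apply: norm_zsum_le; last by apply: zsummableB => //; exact: zsummable_trunc.
  by move=> k; rewrite /ztrunc; case: ifP; rewrite ?subrr ?normr0// !subr0.
apply/cvgrPdist_lt => e e0.
have e3 : 0 < e / 3 by rewrite divr_gt0.
have /cvgrPdist_lt/(_ _ e3)[m _ /(_ m (leqnn m)) gm] := zsum_cvg sg.
have Fm := @cvg_zseries F f m Ff.
have /cvgrPdist_lt/(_ _ e3) Fm3 := Fm.
near=> n.
have -> : zsum f - zsum (F n) = (zsum f - zseries f m) +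
  (zseries f m - zseries (F n) m) - (zsum (F n) - zseries (F n) m) by ring.
rewrite (le_lt_trans (ler_normB _ _))//.
rewrite (_ : e = e / 3 + e / 3 + e / 3); last by field.
have gm' := le_lt_trans (ler_norm _) gm.
rewrite ler_ltD//; last exact: le_lt_trans (tail _ _ (Fg n)) gm'.
rewrite (le_trans (ler_normD _ _))// lerD//.
  by rewrite (le_trans (tail _ _ fg))// ltW.
by apply: ltW; near: n; exact: Fm3.
Unshelve. all: by end_near. Qed.

Definition zl2 f := zsummable (fun k => f k ^+ 2).

Lemma zl2_mul f g : zl2 f -> zl2 g -> zsummable (fun k => f k * g k).
Proof.
move=> sf sg; apply: zsummable_le (zsummableD sf sg) => k.
rewrite normrM -(real_normK (num_real (f k))) -(real_normK (num_real (g k))).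
by nra.
Qed.

Lemma zl2D f g : zl2 f -> zl2 g -> zl2 (fun k => f k + g k).
Proof.
move=> sf sg.
apply: zsummable_le (zsummableZ 2 (zsummableD sf sg)) => k.
by rewrite ger0_norm ?sqr_ge0//; have := sqr_ge0 (f k - g k); nra.
Qed.

Lemma zl2Z a f : zl2 f -> zl2 (fun k => a * f k).
Proof.
move=> sf; rewrite /zl2; under eq_fun do rewrite exprMn.
exact: zsummableZ.
Qed.

Lemma zl2N f : zl2 f -> zl2 (fun k => - f k).
Proof. by move=> sf; rewrite /zl2; under eq_fun do rewrite sqrrN. Qed.

Lemma zl2B f g : zl2 f -> zl2 g -> zl2 (fun k => f k - g k).
Proof. by move=> sf sg; apply: zl2D => //; exact: zl2N. Qed.

Lemma zl2_le f g : (forall k, `|f k| <= g k) -> zl2 g -> zl2 f.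
Proof.
move=> fg sg; apply: zsummable_le sg => k.
by rewrite normrX lerXn2r ?nnegrE// (le_trans _ (fg k)).
Qed.

Lemma zl2_norm f : zl2 f -> zl2 (fun k => `|f k|).
Proof.
by apply: zsummable_le => k; rewrite real_normK ?num_real// ger0_norm ?sqr_ge0.
Qed.

Lemma zsum_sqr_ge0 f : zl2 f -> 0 <= zsum (fun k => f k ^+ 2).
Proof. by move=> sf; apply: zsum_ge0 => // k; exact: sqr_ge0. Qed.

(** The quadratic polynomial t |-> sum_k (t f_k + g_k)^2 is nonnegative, so its
    discriminant is not positive. *)
Lemma zsum_CauchySchwarz f g : zl2 f -> zl2 g ->
  zsum (fun k => f k * g k) ^+ 2 <=
  zsum (fun k => f k ^+ 2) * zsum (fun k => g k ^+ 2).
Proof.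
move=> sf sg; have sfg := zl2_mul sf sg.
set A := zsum (fun k => f k ^+ 2); set B := zsum (fun k => g k ^+ 2).
set P := zsum _.
have quad t : 0 <= A * t ^+ 2 + 2 * t * P + B.
  have : 0 <= zsum (fun k => (t * f k + g k) ^+ 2).
    by apply: zsum_sqr_ge0; apply: zl2D => //; exact: zl2Z.
  rewrite (_ : (fun k => _) =
      (fun k => (t ^+ 2 * f k ^+ 2 + (2 * t) * (f k * g k)) + g k ^+ 2)); last first.
    by apply/funext => k; ring.
  rewrite !zsumD ?zsumZ//; try exact: zsummableZ.
    by rewrite -/A -/B -/P; lra.
  by apply: zsummableD; exact: zsummableZ.
have A0 : 0 <= A by exact: zsum_sqr_ge0.
have [Ae0|An0] := eqVneq A 0.
  have [->|P0] := eqVneq P 0; first by rewrite expr0n/= mulr_ge0// zsum_sqr_ge0.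
  have := quad (- (B + 1) / (2 * P)); rewrite Ae0 mul0r add0r.
  rewrite (_ : 2 * _ * P = - (B + 1)); last by field.
  by lra.
have Ap : 0 < A by rewrite lt_def An0.
have := quad (- P / A).
rewrite (_ : _ + _ = (A * B - P ^+ 2) / A); last by field.
by rewrite pmulr_lge0 ?invr_gt0// subr_ge0.
Qed.

End SumsOverZ.

(** * Unordered sums as limits over symmetric windows *)

Section SumZBridge.
Context {R : realType}.
Implicit Types f g : int -> R.

Lemma esum_int (f : int -> \bar R) : (forall k, 0 <= f k)%E ->
  (\esum_(k in [set: int]) f k = \sum_(0 <= i <oo) (f (Posz i) + f (Negz i)))%E.
Proof.
move=> f0; rewrite (esumID (range Posz))// !setTI.
have -> : ~` range Posz = range Negz.
  apply/seteqP; split => [[i|i] /=|_ [i _ <-] [j _]]//; last by exists i.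
  by move=> h; exfalso; apply: h; exists i.
rewrite !esum_image; [|by move=> i j _ _ []|by move=> i j _ _ []].
by rewrite nneseriesD// !nneseries_esumT.
Qed.

Lemma esum_zsum f : (forall k, 0 <= f k) -> zsummable f ->
  \esum_(k in [set: int]) (f k)%:E = (zsum f)%:E.
Proof.
move=> f0 sf; rewrite esum_int => [|k]; last by rewrite lee_fin.
rewrite (_ : (fun n => _) = EFin \o zseries f); last first.
  by apply/funext => n; rewrite /= /zseries /series/= -sumEFin.
by rewrite EFin_lim//; exact/cvgP/zsum_cvg.
Qed.

Lemma esum_ltoo f : (forall k, 0 <= f k) ->
  (\esum_(k in [set: int]) (f k)%:E < +oo)%E <-> zsummable f.
Proof.
move=> f0; split => [|sf]; last by rewrite esum_zsum// ltry.
rewrite esum_int => [h|k]; last by rewrite lee_fin.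
set S := (X in (X < _)%E) in h.
have S0 : (0 <= S)%E by apply: nneseries_ge0 => n _ _; rewrite adde_ge0// lee_fin.
apply: (@ge0_zsummable _ _ (fine S)) => // n.
rewrite -lee_fin fineK ?ge0_fin_numE//.
rewrite /zseries /series/= -sumEFin; apply: nneseries_lim_ge => i _ _.
by rewrite lee_fin addr_ge0.
Qed.

Lemma sumZ_realE f : zsummable f -> sumZ_real f = zsum f.
Proof.
move=> sf; rewrite /sumZ_real.
have sp : zsummable (fun k => Num.max (f k) 0).
  apply: zsummable_le (zsummable_norm sf) => k.
  by rewrite ger0_norm ?le_max ?lexx ?orbT// ge_max ler_norm normr_ge0.
have sm : zsummable (fun k => Num.max (- f k) 0).
  apply: zsummable_le (zsummable_norm sf) => k.
  by rewrite ger0_norm ?le_max ?lexx ?orbT// ge_max -normrN ler_norm normr_ge0.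
rewrite !esum_zsum//; try by move=> k; rewrite le_max lexx orbT.
rewrite -zsumB//; congr zsum; apply/funext => k.
by case: (leP (f k) 0) => fk; case: (leP (- f k) 0); lra.
Qed.

Lemma zsum_reindex (e : int -> int) f : bijective e -> (forall k, 0 <= f k) ->
  zsummable f -> zsummable (fun k => f (e k)) /\ zsum (fun k => f (e k)) = zsum f.
Proof.
move=> be f0 sf.
have E : \esum_(k in [set: int]) (f k)%:E = \esum_(k in [set: int]) (f (e k))%:E.
  by apply: (@reindex_esum _ _ _ setT setT e); rewrite setTT_bijective.
have se : zsummable (fun k => f (e k)).
  by apply/esum_ltoo => //; rewrite -E; exact/esum_ltoo.
by split => //; apply: EFin_inj; rewrite -!esum_zsum//.
Qed.

End SumZBridge.

(** * The discrete Hilbert transform *)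

Section HilbertKernel.
Context {R : realType}.
Implicit Types (x y f : int -> R) (k l m : int).

(** Up to a factor pi, the Poisson kernel of the half-plane at height N + 1; the
    shift by one keeps it positive for every natural N. *)
Definition poisson_weight (N : nat) k : R :=
  N.+1%:R / (N.+1%:R ^+ 2 + k%:~R ^+ 2).

Lemma poisson_weight_gt0 N k : 0 < poisson_weight N k.
Proof. by rewrite divr_gt0 ?ltr0n// ltr_wpDr ?sqr_ge0// exprn_gt0 ?ltr0n. Qed.

Lemma poisson_weight_ge0 N k : 0 <= poisson_weight N k.
Proof. exact/ltW/poisson_weight_gt0. Qed.

(** Comparison with the telescoping series of 4 M / (M + n) - 4 M / (M + n + 1),
    where M = N + 1, on each of the two half-lines.  The bound is uniform in N,
    which is what makes the averages against these weights comparable. *)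
Lemma zseries_poisson_weight N n : zseries (poisson_weight N) n <= 8.
Proof.
set M : R := N.+1%:R; have M1 : 1 <= M by rewrite ler1n.
suff H : zseries (poisson_weight N) n <= 8 - 8 * M / (M + n%:R).
  rewrite (le_trans H)// gerBl divr_ge0 ?mulr_ge0 ?addr_ge0//; lra.
elim: n => [|n IH]; first by rewrite zseries0 addr0 mulfK ?subrr// gt_eqF//; lra.
rewrite zseriesS.
have n0 : (0:R) <= n%:R by [].
have key (t : R) : 0 <= t -> M / (M ^+ 2 + t ^+ 2) <= 4 * M / (M + t) - 4 * M / (M + (t + 1)).
  move=> t0.
  rewrite (_ : _ - _ = 4 * M / ((M + t) * (M + (t + 1)))); last first.
    by field; apply/andP; split; apply: lt0r_neq0; lra.
  rewrite ler_pdivlMr ?mulr_gt0//; try lra.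
  rewrite mulrAC ler_pdivrMr; last by nra.
  have : (M + t) * (M + (t + 1)) <= 4 * (M ^+ 2 + t ^+ 2).
    have := sqr_ge0 (M - t); nra.
  by nra.
have E : n.+1%:R = n%:R + 1 :> R by rewrite -natr1.
rewrite E.
have h1 : poisson_weight N (Posz n) <= 4 * M / (M + n%:R) - 4 * M / (M + (n%:R + 1)).
  by rewrite /poisson_weight; apply: key.
have h2 : poisson_weight N (Negz n) <= 4 * M / (M + n%:R) - 4 * M / (M + (n%:R + 1)).
  apply: le_trans h1; rewrite /poisson_weight -/M NegzE mulrNz sqrrN.
  rewrite ler_pM2l; last lra.
  rewrite lef_pV2 ?posrE; [|by rewrite -?pmulrn; nra|by rewrite -?pmulrn; nra].
  by rewrite lerD2l -!pmulrn E; nra.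
by lra.
Qed.

Lemma zsummable_poisson_weight N : zsummable (poisson_weight N).
Proof.
exact: ge0_zsummable (poisson_weight_ge0 N) (zseries_poisson_weight N).
Qed.

Lemma zsum_poisson_weight N : zsum (poisson_weight N) <= 8.
Proof.
exact: zsum_le (zsummable_poisson_weight N) (zseries_poisson_weight N).
Qed.

(** The imaginary part of the entries of Pi: Pi_(k,l) is 1/2 on the diagonal plus
    i times this kernel at k - l. *)
Definition hilbert_kernel k : R :=
  if (2 %| k)%Z then 0 else - (pi * k%:~R)^-1.
Local Notation h := hilbert_kernel.

Lemma hilbert_kernelN k : h (- k) = - h k.
Proof.
rewrite /h rpredN; case: ifP => _; first by rewrite oppr0.
by rewrite mulrNz mulrN invrN.
Qed.

Lemma odd_intr_neq0 k : ~~ (2 %| k)%Z -> k%:~R != 0 :> R.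
Proof. by move=> k2; rewrite intr_eq0; apply: contraNneq k2 => ->; rewrite dvdz0. Qed.

Lemma norm_hilbert_kernel k : `|h k| <= (1 + `|k%:~R|)^-1.
Proof.
rewrite /h; case: ifPn => [_|k2]; first by rewrite normr0 invr_ge0 addr_ge0.
have k0 := odd_intr_neq0 k2.
have k1 : 1 <= `|k%:~R| :> R.
  rewrite -intr_norm -[1]/(1%:~R) ler_int -gtz0_ge1 normr_gt0.
  by apply: contraNneq k2 => ->; rewrite dvdz0.
rewrite normrN normfV normrM (ger0_norm (pi_ge0 R)).
have := pi_ge2 R => p2.
by rewrite lef_pV2 ?posrE; nra.
Qed.

Lemma zl2_inv_norm : zl2 (fun k => (1 + `|k%:~R|)^-1 : R).
Proof.
apply: zsummable_le (zsummable_poisson_weight 0) => k.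
rewrite ger0_norm ?sqr_ge0// /poisson_weight expr1n mul1r exprVn.
have n0 := normr_ge0 (k%:~R : R).
rewrite lef_pV2 ?posrE; [|by nra|by have := sqr_ge0 (k%:~R : R); lra].
by rewrite -(real_normK (num_real (k%:~R : R))); nra.
Qed.

Lemma inv_norm_shift k l :
  (1 + `|(k - l)%:~R|)^-1 <= (1 + `|k%:~R|) * (1 + `|l%:~R|)^-1 :> R.
Proof.
rewrite ler_pdivlMr ?ltr_pwDl// ler_pdivrMl ?ltr_pwDl//.
have : `|l%:~R| <= `|k%:~R| + `|(k - l)%:~R| :> R.
  rewrite (_ : l%:~R = k%:~R - (k - l)%:~R) ?ler_normB//.
  by rewrite -intrB opprB addrC subrK.
have := normr_ge0 (k%:~R : R); have := normr_ge0 ((k - l)%:~R : R).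
by nra.
Qed.

Lemma norm_hilbert_kernel_shift k l :
  `|h (k - l)| <= (1 + `|k%:~R|) * (1 + `|l%:~R|)^-1.
Proof. exact: le_trans (norm_hilbert_kernel _) (inv_norm_shift _ _). Qed.

Lemma zl2_hilbert_kernel k : zl2 (fun l => h (k - l)).
Proof.
apply: zl2_le (zl2Z (1 + `|k%:~R|) zl2_inv_norm) => l.
exact: norm_hilbert_kernel_shift.
Qed.

Lemma zl2_hilbert_kernelr k : zl2 (fun l => h (l - k)).
Proof.
rewrite /zl2; under eq_fun do rewrite -opprB hilbert_kernelN sqrrN.
exact: zl2_hilbert_kernel.
Qed.

(** The decay under which all coordinates of the convolution with the kernel, of
    size 1/|n|, are absolutely convergent sums. *)
Definition tempered f := zsummable (fun k => (1 + `|k%:~R|)^-1 * f k).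

Lemma zl2_tempered f : zl2 f -> tempered f.
Proof. by move=> sf; apply: zl2_mul sf; exact: zl2_inv_norm. Qed.

Lemma temperedZ a f : tempered f -> tempered (fun k => a * f k).
Proof.
by move=> sf; rewrite /tempered; under eq_fun do rewrite mulrCA; exact: zsummableZ.
Qed.

Definition hilbert x k := zsum (fun l => h (k - l) * x l).

Lemma zsummable_hilbert x k : tempered x -> zsummable (fun l => h (k - l) * x l).
Proof.
move=> sx.
apply: zsummable_le (zsummableZ (1 + `|k%:~R|) (zsummable_norm sx)) => l.
rewrite !normrM mulrA ler_wpM2r// (le_trans (norm_hilbert_kernel_shift _ _))//.
by rewrite ler_wpM2l ?addr_ge0// ler_norm.
Qed.

Lemma hilbertD x y k : tempered x -> tempered y ->
  hilbert (fun l => x l + y l) k = hilbert x k + hilbert y k.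
Proof.
move=> sx sy; rewrite /hilbert -zsumD; [|exact: zsummable_hilbert..].
by congr zsum; apply/funext => l; rewrite mulrDr.
Qed.

Lemma hilbertZ a x k : tempered x ->
  hilbert (fun l => a * x l) k = a * hilbert x k.
Proof.
move=> sx; rewrite /hilbert -zsumZ; last exact: zsummable_hilbert.
by congr zsum; apply/funext => l; rewrite mulrCA.
Qed.

Lemma hilbertN x k : tempered x -> hilbert (fun l => - x l) k = - hilbert x k.
Proof.
move=> tx; rewrite -[RHS]mulN1r -hilbertZ//; congr hilbert.
by apply/funext => l; rewrite mulN1r.
Qed.

Lemma cvg_inv_natS (a : R) : a / n.+1%:R @[n --> \oo] --> (0 : R).
Proof.
rewrite -[X in _ --> X](mulr0 a); apply: cvgM; first exact: cvg_cst.
exact: cvg_harmonic.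
Qed.

(** The sequence s stands for n |-> n and for n |-> - n, so that both ends of the
    integers are treated at once. *)
Lemma hilbert_kernel_cvg0 (s : nat -> int) k : (forall n, `|s n|%N = n) ->
  h (s n - k) @[n --> \oo] --> 0.
Proof.
move=> sn; apply/norm_cvg0P.
apply: (@squeeze_cvgr _ _ _ _ (fun=> 0) (fun n => (1 + `|k%:~R|) / n.+1%:R)).
- near=> n; rewrite normr_ge0/= -opprB hilbert_kernelN normrN.
  rewrite (le_trans (norm_hilbert_kernel_shift _ _))//.
  have -> : `|(s n)%:~R| = n%:R :> R by rewrite -intr_norm -abszE sn -pmulrn.
  by rewrite nat1r.
- exact: cvg_cst.
- exact: cvg_inv_natS.
Unshelve. all: by end_near. Qed.

Lemma zseries_telescope (psi : int -> R) n :
  zseries (fun k => psi (k + 1) - psi k) n = psi n%:Z - psi (- n%:Z).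
Proof.
elim: n => [|n IH]; first by rewrite zseries0 oppr0 subrr.
rewrite zseriesS IH -!natz -natr1 !natz NegzE.
have -> : - n.+1%:Z + 1 = - n%:Z by rewrite -!natz -natr1; ring.
have -> : - (n%:Z + 1) = - n.+1%:Z by rewrite -!natz -natr1.
by ring.
Qed.

(** Sums of increments telescope to boundary terms, and these vanish because the
    kernel tends to 0 at both ends. *)
Lemma zseries_hilbert_shift l :
  zseries (fun k => h (k - l) - h k) n @[n --> \oo] --> 0.
Proof.
have step m : zseries (fun k => h (k - (m - 1)) - h (k - m)) n @[n --> \oo] --> 0.
  rewrite (_ : (fun n => _) = (fun n : nat => h (n%:Z - m) - h (- n%:Z - m))).
    rewrite -[X in _ --> X](subr0 0); apply: cvgB; apply: hilbert_kernel_cvg0 => n //.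
    by rewrite abszN.
  apply/funext => n; rewrite -(zseries_telescope (fun k => h (k - m))).
  by apply: eq_zseries => k _; congr (h _ - _); ring.
have add f g : zseries f n @[n --> \oo] --> (0:R) -> zseries g n @[n --> \oo] --> (0:R) ->
    zseries (fun k => f k + g k) n @[n --> \oo] --> (0:R).
  move=> sf sg; rewrite (_ : (fun n => _) = zseries f + zseries g).
    by rewrite -[X in _ --> X](addr0 0); exact: cvgD.
  by apply/funext => n; rewrite zseriesD.
have opp f : zseries f n @[n --> \oo] --> (0:R) ->
    zseries (fun k => - f k) n @[n --> \oo] --> (0:R).
  move=> sf; rewrite (_ : (fun n => _) = - zseries f).
    by rewrite -[X in _ --> X]oppr0; exact: cvgN.
  apply/funext => n; rewrite -[RHS]mulN1r -zseriesZ.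
  by apply: eq_zseries => k _; rewrite mulN1r.
elim/int_rect: l => [|n IH|n IH].
- rewrite (_ : zseries _ = fun=> 0); first exact: cvg_cst.
  apply/funext => n; rewrite /zseries /series/= big1// => i _.
  by rewrite !subr0 !subrr addr0.
- rewrite (_ : (fun k => _) = (fun k => (h (k - n%:Z) - h k) +
      - (h (k - (n.+1%:Z - 1)) - h (k - n.+1%:Z)))).
    exact: add IH (opp _ (step _)).
  apply/funext => k.
  have -> : k - (n.+1%:Z - 1) = k - n%:Z by rewrite -!natz -natr1; ring.
  by ring.
- rewrite (_ : (fun k => _) = (fun k => (h (k - - n%:Z) - h k) +
      (h (k - (- n%:Z - 1)) - h (k - - n%:Z)))).
    exact: add IH (step _).
  apply/funext => k.
  have -> : k - (- n%:Z - 1) = k - (- n.+1%:Z) by rewrite -!natz -natr1; ring.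
  by ring.
Qed.

Lemma zsum_0 : zsum (fun=> 0 : R) = 0.
Proof.
apply: zsum_eq; rewrite (_ : zseries _ = fun=> 0); first exact: cvg_cst.
by apply/funext => n; rewrite /zseries /series/= big1// => i _; rewrite addr0.
Qed.

Lemma odd_intP k : ~~ (2 %| k)%Z -> exists j, k = j * 2 + 1.
Proof.
move=> k2; exists (k %/ 2)%Z; rewrite {1}(divz_eq k 2); congr (_ + _).
have : (k %% 2)%Z != 0 by apply: contraNneq k2 => k2; apply/dvdz_mod0P.
have := modz_ge0 k (isT : 2 != 0 :> int); have := ltz_pmod k (isT : 0 < 2 :> int).
by case: (k %% 2)%Z => // -[|[|]].
Qed.

(** If l - m is odd, the two translates have disjoint supports.  Otherwise partial
    fractions turn the product into a constant multiple of the difference of the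
    two translates, whose sum telescopes to 0. *)
Lemma hilbert_kernel_orthogonal l m : l != m ->
  zsum (fun k => h (k - l) * h (k - m)) = 0.
Proof.
move=> lm.
have [lm2|lm2] := boolP (2 %| m - l)%Z; last first.
  rewrite -[RHS]zsum_0; congr zsum; apply/funext => k; rewrite /h.
  case: ifPn => [_|kl]; first by rewrite mul0r.
  case: ifPn => [_|km]; first by rewrite mulr0.
  have [i ki] := odd_intP kl; have [j kj] := odd_intP km.
  exfalso; move/negP: lm2; apply; apply/dvdzP; exists (i - j).
  have -> : m - l = (k - l) - (k - m) by ring.
  by rewrite ki kj; ring.
have d0 : (m - l)%:~R != 0 :> R by rewrite intr_eq0 subr_eq0 eq_sym.
have p0 : pi != 0 :> R by rewrite gt_eqF// pi_gt0.
apply: zsum_eq.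
rewrite (_ : zseries _ = (fun n => - (pi * (m - l)%:~R)^-1 *
    (zseries (fun k => h (k - m) - h k) n - zseries (fun k => h (k - l) - h k) n))).
  rewrite -[X in _ --> X](mulr0 (- (pi * (m - l)%:~R)^-1)); apply: cvgM; first exact: cvg_cst.
  by rewrite -[X in _ --> X](subr0 0); apply: cvgB; exact: zseries_hilbert_shift.
apply/funext => n; rewrite -[X in _ * (_ + X)]mulN1r -zseriesZ -zseriesD -zseriesZ.
apply: eq_zseries => k _.
have -> : h (k - m) - h k + -1 * (h (k - l) - h k) = h (k - m) - h (k - l) by ring.
have km2 : (2 %| k - m)%Z = (2 %| k - l)%Z.
  have -> : k - l = (k - m) + (m - l) by ring.
  by rewrite [RHS]rpredDr.
rewrite /h km2; case: ifPn => kl; first by rewrite subr0 !mulr0.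
have kl0 := odd_intr_neq0 kl.
have km0 : (k - m)%:~R != 0 :> R by apply: odd_intr_neq0; rewrite km2.
move: d0 kl0 km0; rewrite !intrB => d0 kl0 km0.
move: (k%:~R : R) (l%:~R : R) (m%:~R : R) (pi : R) d0 kl0 km0 p0.
move=> a b c p d0 kl0 km0 p0.
by field; rewrite p0 d0 kl0 km0.
Qed.

Definition hilbert_const : R := zsum (fun k => h k ^+ 2).

Lemma zsum_hilbert_kernel_sqr l : zsum (fun k => h (k - l) ^+ 2) = hilbert_const.
Proof.
have [|||_] := @zsum_reindex R (fun k => k - l) (fun k => h k ^+ 2).
- by exists (fun k => k + l) => k; ring.
- by move=> k; exact: sqr_ge0.
- by have := zl2_hilbert_kernelr 0; rewrite /zl2; under eq_fun do rewrite subr0.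
- by [].
Qed.

Definition zrange n : seq int :=
  [seq Posz i | i <- iota 0 n] ++ [seq Negz i | i <- iota 0 n].

Lemma zrange_uniq n : uniq (zrange n).
Proof.
rewrite cat_uniq !map_inj_uniq ?iota_uniq/=; try by move=> i j [].
by rewrite andbT; apply/hasPn => _ /mapP[i _ ->]; apply/mapP => -[].
Qed.

Lemma zseries_zrange f n : zseries f n = \sum_(k <- zrange n) f k.
Proof.
rewrite /zseries /series/= big_split/= big_cat/= !big_map.
by rewrite /index_iota subn0.
Qed.

Lemma zl2_sum (s : seq int) x (F : int -> int -> R) : (forall m, zl2 (F m)) ->
  zl2 (fun k => \sum_(m <- s) x m * F m k).
Proof.
move=> sF; elim: s => [|m s IH].
  under eq_fun do rewrite big_nil.
  by apply: zl2_le (zl2_norm (sF 0)) => k; rewrite normr0.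
under eq_fun do rewrite big_cons.
by apply: zl2D => //; exact: zl2Z.
Qed.

Lemma zsum_mul_sum (s : seq int) x (F : int -> int -> R) g : zl2 g ->
  (forall m, zl2 (F m)) ->
  zsum (fun k => (\sum_(m <- s) x m * F m k) * g k) =
  \sum_(m <- s) x m * zsum (fun k => F m k * g k).
Proof.
move=> sg sF; elim: s => [|m s IH].
  by rewrite big_nil -[RHS]zsum_0; congr zsum; apply/funext => k; rewrite big_nil mul0r.
rewrite big_cons -IH -zsumZ; last exact: zl2_mul.
rewrite -zsumD.
- by congr zsum; apply/funext => k; rewrite big_cons; ring.
- by apply: zsummableZ; exact: zl2_mul.
- by apply: zl2_mul => //; exact: zl2_sum.
Qed.

(** Pythagoras, as the translates of the kernel are orthogonal of equal norm. *)
Lemma hilbert_isometry_seq (s : seq int) x : uniq s ->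
  zsum (fun k => (\sum_(m <- s) x m * h (k - m)) ^+ 2) =
  hilbert_const * \sum_(m <- s) x m ^+ 2.
Proof.
elim: s => [_|m s IH /= /andP[ms us]].
  rewrite big_nil mulr0 -[RHS]zsum_0; congr zsum; apply/funext => k.
  by rewrite big_nil expr0n.
have S : zl2 (fun k => \sum_(m <- s) x m * h (k - m)).
  exact: (@zl2_sum _ _ (fun m k => h (k - m))) zl2_hilbert_kernelr.
have M : zl2 (fun k => x m * h (k - m)) by apply: zl2Z; exact: zl2_hilbert_kernelr.
rewrite big_cons mulrDr -IH//.
have cross : zsum (fun k => (\sum_(m <- s) x m * h (k - m)) * h (k - m)) = 0.
  rewrite (@zsum_mul_sum _ _ (fun m k => h (k - m)))//; last 2 first.
  - exact: zl2_hilbert_kernelr.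
  - exact: zl2_hilbert_kernelr.
  rewrite big1_seq// => j /andP[_ js].
  by rewrite hilbert_kernel_orthogonal ?mulr0//; apply: contraNneq ms => <-.
rewrite -(zsum_hilbert_kernel_sqr m) mulrC -zsumZ; last exact: zl2_hilbert_kernelr.
have crossS : zsummable (fun k => 2 * x m *
    ((\sum_(m <- s) x m * h (k - m)) * h (k - m))).
  by apply: zsummableZ; apply: zl2_mul => //; exact: zl2_hilbert_kernelr.
have cross0 : zsum (fun k => 2 * x m *
    ((\sum_(m <- s) x m * h (k - m)) * h (k - m))) = 0.
  by rewrite zsumZ ?cross ?mulr0//; apply: zl2_mul => //; exact: zl2_hilbert_kernelr.
rewrite -[RHS]addr0 -[X in _ + X]cross0 -!zsumD//.
- by congr zsum; apply/funext => k; rewrite big_cons; ring.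
- by apply: zsummableD => //; apply: zsummableZ; exact: zl2_hilbert_kernelr.
- by apply: zsummableZ; exact: zl2_hilbert_kernelr.
Qed.

Lemma hilbert_trunc n x k :
  hilbert (ztrunc n x) k = \sum_(m <- zrange n) x m * h (k - m).
Proof.
rewrite /hilbert.
rewrite (_ : (fun l => _) = ztrunc n (fun l => x l * h (k - l))).
  by rewrite zsum_trunc zseries_zrange.
by apply/funext => l; rewrite /ztrunc; case: ifP => _; rewrite ?mulr0 1?mulrC.
Qed.

(** The isometry on finitely supported sequences survives as an inequality, since
    the transforms of the truncations of x converge coordinatewise. *)
Lemma hilbert_bounded x : zl2 x -> zl2 (hilbert x) /\
  zsum (fun k => hilbert x k ^+ 2) <= hilbert_const * zsum (fun k => x k ^+ 2).
Proof.
move=> sx; have tx := zl2_tempered sx.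
have c0 : 0 <= hilbert_const.
  rewrite -(zsum_hilbert_kernel_sqr 0); apply: zsum_sqr_ge0.
  exact: zl2_hilbert_kernelr.
have bnd (m : nat) : zseries (fun k => hilbert x k ^+ 2) m <=
    hilbert_const * zsum (fun k => x k ^+ 2).
  have cv : zseries (fun k => hilbert (ztrunc n x) k ^+ 2) m @[n --> \oo] -->
      zseries (fun k => hilbert x k ^+ 2) m.
    apply: cvg_zseries => k.
    suff H : hilbert (ztrunc n x) k @[n --> \oo] --> hilbert x k.
      by under eq_fun do rewrite expr2; rewrite expr2; exact: cvgM.
    under eq_fun do rewrite hilbert_trunc.
    rewrite (_ : (fun n => _) = zseries (fun l => h (k - l) * x l)).
      by apply: zsum_cvg; exact: zsummable_hilbert.
    apply/funext => n; rewrite zseries_zrange; apply: eq_bigr => l _.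
    by rewrite mulrC.
  rewrite -(cvg_lim _ cv)//; apply: limr_le; first exact/cvgP/cv.
  near=> n.
  have E : (fun k => hilbert (ztrunc n x) k ^+ 2) =
      (fun k => (\sum_(m <- zrange n) x m * h (k - m)) ^+ 2).
    by apply/funext => k; rewrite hilbert_trunc.
  have S : zl2 (hilbert (ztrunc n x)).
    rewrite (_ : hilbert _ = fun k => \sum_(m <- zrange n) x m * h (k - m)).
      exact: (@zl2_sum _ _ (fun m k => h (k - m))) zl2_hilbert_kernelr.
    by apply/funext => k; rewrite hilbert_trunc.
  rewrite (le_trans (zseries_le_zsum _ S _))//; first by move=> k; exact: sqr_ge0.
  rewrite E hilbert_isometry_seq ?zrange_uniq// ler_wpM2l// -zseries_zrange.
  by apply: zseries_le_zsum => // k; exact: sqr_ge0.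
have S : zl2 (hilbert x) by apply: ge0_zsummable bnd => k; exact: sqr_ge0.
by split => //; exact: zsum_le.
Unshelve. all: by end_near. Qed.

(** The double sum is not absolutely convergent in general.  The identity is
    clear for truncations of x, and the error is controlled by boundedness. *)
Lemma hilbert_antisym x y : zl2 x -> zl2 y ->
  zsum (fun k => hilbert x k * y k) = - zsum (fun k => x k * hilbert y k).
Proof.
move=> sx sy.
have [shx _] := hilbert_bounded sx; have [shy _] := hilbert_bounded sy.
pose x' n := ztrunc n x; pose r n k := x k - x' n k.
have sx' n : zl2 (x' n).
  by apply: zl2_le (zl2_norm sx) => k; rewrite /x' /ztrunc; case: ifP; rewrite ?normr0.
have E1 n : zsum (fun k => hilbert (x' n) k * y k) =
    - zseries (fun k => x k * hilbert y k) n.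
  rewrite (_ : (fun k => _) = fun k => (\sum_(m <- zrange n) x m * h (k - m)) * y k).
    rewrite (@zsum_mul_sum _ _ (fun m k => h (k - m)))//; last exact: zl2_hilbert_kernelr.
    rewrite zseries_zrange -sumrN; apply: eq_bigr => m _.
    rewrite -mulrN; congr (_ * _); rewrite /hilbert -zsumN.
      by congr zsum; apply/funext => k; rewrite -mulNr -hilbert_kernelN opprB.
    exact/zsummable_hilbert/zl2_tempered.
  by apply/funext => k; rewrite hilbert_trunc.
have Y0 : 0 <= zsum (fun k => y k ^+ 2) by exact: zsum_sqr_ge0.
have E2 n : (zsum (fun k => hilbert x k * y k) -
    zsum (fun k => hilbert (x' n) k * y k)) ^+ 2 <=
    (hilbert_const * zsum (fun k => y k ^+ 2)) *
    (zsum (fun k => x k ^+ 2) - zseries (fun k => x k ^+ 2) n).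
  have sr : zl2 (r n) by exact: zl2B.
  have [shr hr] := hilbert_bounded sr; have [shx' _] := hilbert_bounded (sx' n).
  rewrite -zsumB; [|exact: zl2_mul..].
  rewrite (_ : (fun k => _) = fun k => hilbert (r n) k * y k); last first.
    apply/funext => k; rewrite -mulrBl; congr (_ * _).
    rewrite (_ : r n = fun l => x l + -1 * x' n l).
      rewrite hilbertD ?hilbertZ ?mulN1r//; try exact/zl2_tempered.
      exact/temperedZ/zl2_tempered.
    by apply/funext => l; rewrite /r mulN1r.
  rewrite (le_trans (zsum_CauchySchwarz shr sy))//.
  rewrite mulrAC ler_wpM2r// (le_trans hr)//.
  rewrite (_ : zsum (fun k => r n k ^+ 2) = zsum (fun k => x k ^+ 2) -
      zseries (fun k => x k ^+ 2) n)//.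
  rewrite -zsum_trunc -zsumB//; last exact: zsummable_trunc.
  congr zsum; apply/funext => k; rewrite /r /x' /ztrunc; case: ifP => _.
    by rewrite !subrr expr0n.
  by rewrite !subr0.
set L := zsum _; set A := zsum _.
have cA : (L - - zseries (fun k => x k * hilbert y k) n) ^+ 2 @[n --> \oo] -->
    (L + A) ^+ 2.
  under eq_fun do rewrite expr2 opprK; rewrite expr2.
  have cA : zseries (fun k => x k * hilbert y k) @ \oo --> A.
    by apply: zsum_cvg; exact: zl2_mul.
  by apply: cvgM; (apply: cvgD; [exact: cvg_cst|exact: cA]).
have c0 : (L - - zseries (fun k => x k * hilbert y k) n) ^+ 2 @[n --> \oo] --> 0.
  apply: (@squeeze_cvgr _ _ _ _ (fun=> 0) (fun n =>
    (hilbert_const * zsum (fun k => y k ^+ 2)) *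
    (zsum (fun k => x k ^+ 2) - zseries (fun k => x k ^+ 2) n))).
  - by near=> n; rewrite sqr_ge0/= -E1; exact: E2.
  - exact: cvg_cst.
  - rewrite -[X in _ --> X](mulr0 (hilbert_const * zsum (fun k => y k ^+ 2))).
    apply: cvgM; first exact: cvg_cst.
    rewrite -[X in _ --> X](subrr (zsum (fun k => x k ^+ 2))).
    by apply: cvgB; [exact: cvg_cst|exact: zsum_cvg].
have /eqP : (L + A) ^+ 2 = 0 by apply: (cvg_unique (@norm_hausdorff _ R) cA c0).
by rewrite sqrf_eq0 addr_eq0 => /eqP.
Unshelve. all: by end_near. Qed.

End HilbertKernel.

(** * Cutoffs and the commutator with the Hilbert transform *)

Section Cutoff.
Context {R : realType}.
Implicit Types (f q w x y : int -> R) (k l : int) (N : nat).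
Local Notation h := (@hilbert_kernel R).

Definition cutoff N k : R := N.+1%:R * poisson_weight N k.
Definition root_weight N k : R := Num.sqrt (poisson_weight N k).
Local Notation s := root_weight.

Lemma root_weight_sqr N k : s N k ^+ 2 = poisson_weight N k.
Proof. by rewrite sqr_sqrtr// poisson_weight_ge0. Qed.

Lemma root_weight_ge0 N k : 0 <= s N k. Proof. exact: sqrtr_ge0. Qed.

Lemma poisson_weight_le N k : poisson_weight N k <= N.+1%:R^-1 :> R.
Proof.
rewrite /poisson_weight; set M : R := N.+1%:R.
have M0 : 0 < M by rewrite ltr0n.
rewrite ler_pdivrMr; last by rewrite ltr_wpDr ?sqr_ge0// exprn_gt0.
by rewrite mulrDr expr2 mulrA mulVf ?gt_eqF// mul1r lerDl mulr_ge0 ?sqr_ge0// invr_ge0 ltW.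
Qed.

Lemma intr_root_weight_le N k l : `|k%:~R| * (s N k * s N l) <= 1.
Proof.
rewrite -(ler_pXn2r (n := 2)) ?nnegrE ?mulr_ge0 ?root_weight_ge0//.
rewrite expr1n exprMn exprMn !root_weight_sqr real_normK ?num_real//.
have := poisson_weight_le N l; have := poisson_weight_ge0 N l (R := R).
set b := poisson_weight N l => b0 bM; rewrite /poisson_weight.
set M : R := N.+1%:R in bM *; have M0 : 0 < M by rewrite ltr0n.
have S0 := sqr_ge0 (k%:~R : R).
set S := (k%:~R : R) ^+ 2 in S0 *.
rewrite (_ : S * _ = (S / (M ^+ 2 + S)) * (M * b)); last by ring.
apply: mulr_ile1.
- by rewrite divr_ge0// addr_ge0// sqr_ge0.
- by rewrite mulr_ge0// ltW.
- by rewrite ler_pdivrMr ?mul1r ?lerDr ?sqr_ge0// ltr_wpDr// exprn_gt0.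
- by rewrite (le_trans (ler_wpM2l (ltW M0) bM))// divff// gt_eqF.
Qed.

(** Put s for [root_weight].  Then chi_N(l) - chi_N(k) = (k^2 - l^2) s(k)^2 s(l)^2:
    the factor k - l cancels the singularity of the kernel, and the remaining
    factor |k + l| s(k) s(l) is at most 2. *)
Lemma commutator_le N k l :
  `|h (k - l) * (cutoff N l - cutoff N k)| <= 2 * s N k * s N l.
Proof.
rewrite /hilbert_kernel; case: ifPn => [_|kl].
  by rewrite mul0r normr0 !mulr_ge0// root_weight_ge0.
have kl0 := odd_intr_neq0 kl (R := R).
rewrite (_ : cutoff N l - cutoff N k = (k - l)%:~R * ((k%:~R + l%:~R) *
    (poisson_weight N k * poisson_weight N l))); last first.
  rewrite /cutoff /poisson_weight intrB; set M : R := N.+1%:R.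
  have M0 : 0 < M by rewrite ltr0n.
  have pos (t : R) : M ^+ 2 + t ^+ 2 != 0.
    by rewrite gt_eqF// ltr_wpDr ?sqr_ge0// exprn_gt0.
  have := pos k%:~R; have := pos l%:~R.
  move: (k%:~R : R) (l%:~R : R) M {M0 kl kl0 pos} => a b M M1 M2.
  by field; rewrite M1 M2.
have E (p D X : R) : D != 0 -> - (p * D)^-1 * (D * X) = - (p^-1 * X).
  by move=> D0; rewrite invfM mulNr -mulrA mulKf.
rewrite E// normrN.
rewrite -!root_weight_sqr normrM normfV (ger0_norm (pi_ge0 R)).
have a0 := root_weight_ge0 N k; have b0 := root_weight_ge0 N l.
rewrite (_ : (_ + _) * _ = ((k%:~R * (s N k * s N l) + l%:~R * (s N l * s N k)) *
    (s N k * s N l))); last by ring.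
rewrite normrM (ger0_norm (mulr_ge0 a0 b0)) mulrA -[leRHS]mulrA ler_wpM2r ?mulr_ge0//.
rewrite ler_pdivrMl ?pi_gt0//.
have h1 := intr_root_weight_le N k l; have h2 := intr_root_weight_le N l k.
rewrite (le_trans (ler_normD _ _))// !normrM !(ger0_norm a0) !(ger0_norm b0).
have := pi_ge2 R; lra.
Qed.

Lemma cutoff_ge0 N k : 0 <= cutoff N k.
Proof. by rewrite mulr_ge0// poisson_weight_ge0. Qed.

Lemma cutoff_le1 N k : cutoff N k <= 1.
Proof.
rewrite /cutoff (le_trans (ler_wpM2l _ (poisson_weight_le N k)))//.
by rewrite divff// pnatr_eq0.
Qed.

Lemma cutoff_cvg k : cutoff N k @[N --> \oo] --> (1 : R).
Proof.
apply: (@squeeze_cvgr _ _ _ _ (fun N => 1 - k%:~R ^+ 2 / N.+1%:R) (fun=> 1)).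
- near=> N; rewrite cutoff_le1 andbT /cutoff /poisson_weight.
  set M : R := N.+1%:R; have M1 : 1 <= M by rewrite ler1n.
  have S0 := sqr_ge0 (k%:~R : R).
  set S := (k%:~R : R) ^+ 2 in S0 *.
  rewrite mulrA ler_pdivlMr; last by nra.
  have T0 : 0 <= S / M by rewrite divr_ge0//; lra.
  have {S0} : S = S / M * M by rewrite divfK// gt_eqF//; lra.
  move: (S / M) T0 => T T0 ->.
  have : 0 <= T * M * (M - 1) by rewrite !mulr_ge0//; lra.
  have : 0 <= T * T * M by rewrite !mulr_ge0//; lra.
  by nra.
- by rewrite -[X in _ --> X]subr0; apply: cvgB; [exact: cvg_cst|exact: cvg_inv_natS].
- exact: cvg_cst.
Unshelve. all: by end_near. Qed.

Lemma root_weight_le N k : s N k <= 2 * N.+1%:R * (1 + `|k%:~R|)^-1.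
Proof.
have k0 := normr_ge0 (k%:~R : R).
rewrite ler_pdivlMr ?ltr_pwDl//.
rewrite -(ler_pXn2r (n := 2)) ?nnegrE ?mulr_ge0 ?root_weight_ge0 ?addr_ge0//.
rewrite exprMn root_weight_sqr /poisson_weight.
set M : R := N.+1%:R; have M1 : 1 <= M by rewrite ler1n.
rewrite -[in X in X <= _](real_normK (num_real (k%:~R : R))).
set a := `|_|; rewrite mulrAC ler_pdivrMr; last by nra.
have : (1 + a) ^+ 2 <= 2 * (1 + a ^+ 2) by have := sqr_ge0 (1 - a); nra.
have a0 : 0 <= a by [].
move: (sqr_ge0 a); set A := a ^+ 2 => A0 H.
have M2 : M <= M ^+ 2 by nra.
have : M * (1 + a) ^+ 2 <= M ^+ 2 * (2 * (1 + A)) by apply: ler_pM => //; (exact: sqr_ge0 || lra).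
have : 0 <= M ^+ 2 * (M ^+ 2 - 1) by rewrite mulr_ge0 ?sqr_ge0//; nra.
have : 0 <= M ^+ 2 * A by rewrite mulr_ge0 ?sqr_ge0.
nra.
Qed.

Lemma cutoff_le N k : cutoff N k <= 2 * N.+1%:R ^+ 2 * (1 + `|k%:~R|)^-1.
Proof.
rewrite /cutoff -root_weight_sqr expr2.
have s1 : s N k <= 1.
  rewrite -(ler_pXn2r (n := 2)) ?nnegrE ?root_weight_ge0// root_weight_sqr expr1n.
  by rewrite (le_trans (poisson_weight_le _ _))// invf_le1 ?ler1n.
rewrite expr2 mulrA -mulrA -[leRHS](_ : N.+1%:R * (2 * N.+1%:R * (1 + `|k%:~R|)^-1) = _); last by ring.
by rewrite ler_wpM2l// (le_trans _ (root_weight_le _ _))// ler_piMr// root_weight_ge0.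
Qed.

Lemma zsummable_zl2 f : zsummable f -> zl2 f.
Proof.
move=> sf; have sa := zsummable_norm sf.
apply: zsummable_le (zsummableZ (zsum (fun k => `|f k|)) sa) => k.
rewrite normrX expr2 ler_wpM2r//.
by apply: ler_zsum_term sa _ => j; exact: normr_ge0.
Qed.

Lemma zl2_root_weight N : zl2 (s N).
Proof.
rewrite /zl2; under eq_fun do rewrite root_weight_sqr.
exact: zsummable_poisson_weight.
Qed.

Lemma root_weight_cvg0 k : s N k @[N --> \oo] --> (0 : R).
Proof.
apply: (@squeeze_cvgr _ _ _ _ (fun=> 0) (fun N => Num.sqrt N.+1%:R^-1)).
- near=> N; rewrite root_weight_ge0/= ler_wsqrtr// poisson_weight_le//.
- exact: cvg_cst.
- rewrite -(@sqrtr0 R); apply: continuous_cvg; first exact: sqrt_continuous.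
  exact: cvg_harmonic.
Unshelve. all: by end_near. Qed.

Definition window_sum N f := zsum (fun k => `|f k| * s N k).

Lemma window_sum_ge0 N f : zsummable (fun k => `|f k| * s N k) -> 0 <= window_sum N f.
Proof. by move=> sf; apply: zsum_ge0 => // k; rewrite mulr_ge0 ?root_weight_ge0. Qed.

Lemma zsummable_window N f : tempered f -> zsummable (fun k => `|f k| * s N k).
Proof.
move=> sf; apply: zsummable_le (zsummableZ (2 * N.+1%:R) (zsummable_norm sf)) => k.
rewrite ger0_norm ?mulr_ge0 ?root_weight_ge0// normrM normfV (ger0_norm (addr_ge0 _ _))//.
by rewrite mulrA [leRHS]mulrC ler_wpM2l// root_weight_le.
Qed.

(** For d > 0, |f| s <= d s^2 + phi with phi = max (|f| s - d s^2, 0).  The sum of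
    d s^2 is at most 8 d, while phi is dominated by f^2 / (4 d) and tends to 0
    pointwise. *)
Lemma window_sum_cvg0 f : zl2 f -> window_sum N f @[N --> \oo] --> 0.
Proof.
move=> sf; apply/cvgrPdist_lt => e e0.
set d := e / 16; have d0 : 0 < d by rewrite divr_gt0.
pose phi N k := Num.max (`|f k| * s N k - d * poisson_weight N k) 0.
have phile N k : phi N k <= (4 * d)^-1 * f k ^+ 2.
  rewrite /phi -root_weight_sqr ge_max mulr_ge0 ?sqr_ge0 ?invr_ge0 ?andbT//; last lra.
  rewrite ler_pdivlMl; last lra.
  rewrite -(real_normK (num_real (f k))).
  by have := sqr_ge0 (`|f k| - 2 * d * s N k); nra.
have phi0 N k : 0 <= phi N k by rewrite le_max lexx orbT.
have sphi : zsummable (fun k => (4 * d)^-1 * f k ^+ 2) by exact: zsummableZ.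
have : zsum (phi N) @[N --> \oo] --> zsum (fun=> 0 : R).
  apply: zsum_dominated_cvg sphi _ _ => [N k|k]; first by rewrite ger0_norm.
  apply: (@squeeze_cvgr _ _ _ _ (fun=> 0) (fun N => `|f k| * s N k)).
  - near=> N; rewrite phi0/= ge_max mulr_ge0 ?root_weight_ge0// andbT.
    by rewrite gerBl mulr_ge0 ?poisson_weight_ge0// ltW.
  - exact: cvg_cst.
  - rewrite -[X in _ --> X](mulr0 `|f k|); apply: cvgM; first exact: cvg_cst.
    exact: root_weight_cvg0.
rewrite zsum_0 => /cvgrPdist_lt/(_ _ d0) H; near=> N.
have tw := zsummable_window N (zl2_tempered sf).
rewrite sub0r normrN ger0_norm ?window_sum_ge0//.
have sp : zsummable (phi N) by apply: zsummable_le sphi => k; rewrite ger0_norm.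
apply: (@le_lt_trans _ _ (d * zsum (poisson_weight N) + zsum (phi N))).
  have swp := zsummable_poisson_weight N (R := R).
  rewrite -zsumZ// -zsumD//; last exact: zsummableZ.
  apply: ler_zsum => //; first by apply: zsummableD => //; exact: zsummableZ.
  by move=> k; rewrite -lerBlDl le_max lexx.
have h1 : d * zsum (poisson_weight N) <= d * 8.
  by rewrite ler_wpM2l ?zsum_poisson_weight// ltW.
have h2 : zsum (phi N) < d.
  rewrite (le_lt_trans (ler_norm _))// -normrN -sub0r.
  by near: N; exact: H.
have ed : e = d * 16 by rewrite /d divfK.
by move: ed h1 h2; move: (zsum _) (zsum _) => A B; lra.
Unshelve. all: by end_near. Qed.

(** The cutoff commutes with the Hilbert transform up to the operator K, whose
    kernel is bounded by [commutator_le]; once the cutoff has made q square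
    summable, [hilbert_antisym] applies. *)
Lemma hilbert_cutoff w q N : zl2 w -> tempered q ->
  [/\ zl2 (fun k => cutoff N k * q k),
      zl2 (fun k => cutoff N k * hilbert q k) &
      `|zsum (fun k => w k * (cutoff N k * hilbert q k)) +
        zsum (fun k => hilbert w k * (cutoff N k * q k))| <=
      2 * window_sum N w * window_sum N q].
Proof.
move=> sw tq; have twin := zsummable_window N tq.
have scq : zl2 (fun k => cutoff N k * q k).
  apply: zsummable_zl2.
  apply: zsummable_le (zsummableZ (2 * N.+1%:R ^+ 2) (zsummable_norm tq)) => k.
  rewrite normrM (ger0_norm (cutoff_ge0 _ _)) normrM normfV (ger0_norm (addr_ge0 _ _))//.
  by rewrite mulrA ler_wpM2r// cutoff_le.
pose K k := zsum (fun l => h (k - l) * (cutoff N l - cutoff N k) * q l).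
have Kle k l : `|h (k - l) * (cutoff N l - cutoff N k) * q l| <=
    2 * s N k * (`|q l| * s N l).
  by rewrite normrM [X in _ <= _ * X]mulrC mulrA ler_wpM2r// commutator_le.
have sK k : zsummable (fun l => 2 * s N k * (`|q l| * s N l)) by exact: zsummableZ.
have normK k : `|K k| <= 2 * window_sum N q * s N k.
  rewrite (le_trans (norm_zsum_le (Kle k) (sK k)))// zsumZ//.
  by rewrite -/(window_sum N q) mulrAC.
have sKK : zl2 K by apply: zl2_le normK _; apply: zl2Z; exact: zl2_root_weight.
have E k : cutoff N k * hilbert q k = hilbert (fun l => cutoff N l * q l) k - K k.
  rewrite /hilbert /K -zsumZ; last exact: zsummable_hilbert.
  rewrite -zsumB.
  - by congr zsum; apply/funext => l; ring.
  - exact/zsummable_hilbert/zl2_tempered.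
  - exact: zsummable_le (Kle k) (sK k).
have [shc _] := hilbert_bounded scq.
have [shw _] := hilbert_bounded sw.
have sch : zl2 (fun k => cutoff N k * hilbert q k).
  by under eq_fun do rewrite E; exact: zl2B.
split => //.
have -> : zsum (fun k => w k * (cutoff N k * hilbert q k)) =
    zsum (fun k => w k * hilbert (fun l => cutoff N l * q l) k) - zsum (fun k => w k * K k).
  rewrite -zsumB; [|exact: zl2_mul..].
  by congr zsum; apply/funext => k; rewrite E mulrBr.
rewrite (hilbert_antisym sw scq) addrAC subrr sub0r normrN mulrAC.
have swN := zsummable_window N (zl2_tempered sw).
rewrite -[leRHS]zsumZ//; apply: norm_zsum_le; last exact: zsummableZ.
by move=> k; rewrite normrM [leRHS]mulrCA ler_wpM2l.
Qed.

End Cutoff.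

(** * Symmetry of the compressed multiplication *)

Section RealProjection.
Context {R : realType}.
Implicit Types (f a b c d p r g rho : int -> R) (k : int) (N : nat).

(** Real and imaginary parts of Pi (a + i b). *)
Definition proj_re a b k : R := a k / 2 - hilbert b k.
Definition proj_im a b k : R := b k / 2 + hilbert a k.

Lemma zl2_proj_re a b : zl2 a -> zl2 b -> zl2 (proj_re a b).
Proof.
move=> sa sb; apply: zl2B; last by have [] := hilbert_bounded sb.
by rewrite /zl2; under eq_fun do rewrite mulrC; exact: zl2Z.
Qed.

Lemma zl2_proj_im a b : zl2 a -> zl2 b -> zl2 (proj_im a b).
Proof.
move=> sa sb; apply: zl2D; last by have [] := hilbert_bounded sa.
by rewrite /zl2; under eq_fun do rewrite mulrC; exact: zl2Z.
Qed.

Lemma proj_symmetric a b p r : zl2 a -> zl2 b -> zl2 p -> zl2 r ->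
  zsum (fun k => a k * proj_re p r k + b k * proj_im p r k) =
  zsum (fun k => proj_re a b k * p k + proj_im a b k * r k).
Proof.
move=> sa sb sp sr.
have [ha _] := hilbert_bounded sa; have [hb _] := hilbert_bounded sb.
have [hp _] := hilbert_bounded sp; have [hr _] := hilbert_bounded sr.
have S1 := zl2_mul sa hr; have S2 := zl2_mul sb hp.
have S3 := zl2_mul ha sr; have S4 := zl2_mul hb sp.
have S5 := zl2_mul sa sp; have S6 := zl2_mul sb sr.
apply/eqP; rewrite -subr_eq0 -zsumB; last 2 first.
- by apply: zsummableD; apply: zl2_mul => //; [exact: zl2_proj_re|exact: zl2_proj_im].
- by apply: zsummableD; apply: zl2_mul => //; [exact: zl2_proj_re|exact: zl2_proj_im].
rewrite (_ : (fun k => _) = fun k => (b k * hilbert p k + hilbert b k * p k) -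
   (a k * hilbert r k + hilbert a k * r k)); last first.
  by apply/funext => k; rewrite /proj_re /proj_im; ring.
rewrite zsumB ?zsumD//; try exact: zsummableD.
rewrite (hilbert_antisym sb sp) (hilbert_antisym sa sr).
by rewrite !subrr.
Qed.

Lemma proj_cutoff a b p r N : zl2 a -> zl2 b -> tempered p -> tempered r ->
  `|zsum (fun k => cutoff N k * (a k * proj_re p r k + b k * proj_im p r k)) -
    zsum (fun k => cutoff N k * (proj_re a b k * p k + proj_im a b k * r k))| <=
  2 * window_sum N a * window_sum N r + 2 * window_sum N b * window_sum N p.
Proof.
move=> sa sb tp tr.
have [cp chp _] := hilbert_cutoff N sa tp.
have [cr chr Ear] := hilbert_cutoff N sa tr.
have [_ _ Ebp] := hilbert_cutoff N sb tp.
have [sha _] := hilbert_bounded sa; have [shb _] := hilbert_bounded sb.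
have S1 := zl2_mul sa cp; have S2 := zl2_mul sa chr.
have S3 := zl2_mul sb cr; have S4 := zl2_mul sb chp.
have S5 := zl2_mul shb cp; have S6 := zl2_mul sha cr.
set A := zsum (fun k => a k * (cutoff N k * p k)).
set B := zsum (fun k => b k * (cutoff N k * r k)).
have -> : zsum (fun k => cutoff N k * (a k * proj_re p r k + b k * proj_im p r k)) =
   (2^-1 * A - zsum (fun k => a k * (cutoff N k * hilbert r k))) +
   (2^-1 * B + zsum (fun k => b k * (cutoff N k * hilbert p k))).
  rewrite -!zsumZ// -zsumB//; last exact: zsummableZ.
  rewrite -zsumD//; last exact: zsummableZ.
  rewrite -zsumD.
  - by congr zsum; apply/funext => k; rewrite /proj_re /proj_im; ring.
  - by apply: zsummableB => //; exact: zsummableZ.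
  - by apply: zsummableD => //; exact: zsummableZ.
have -> : zsum (fun k => cutoff N k * (proj_re a b k * p k + proj_im a b k * r k)) =
   (2^-1 * A - zsum (fun k => hilbert b k * (cutoff N k * p k))) +
   (2^-1 * B + zsum (fun k => hilbert a k * (cutoff N k * r k))).
  rewrite -!zsumZ// -zsumB//; last exact: zsummableZ.
  rewrite -zsumD//; last exact: zsummableZ.
  rewrite -zsumD.
  - by congr zsum; apply/funext => k; rewrite /proj_re /proj_im; ring.
  - by apply: zsummableB => //; exact: zsummableZ.
  - by apply: zsummableD => //; exact: zsummableZ.
move: Ear Ebp.
set x1 := zsum _; set x2 := zsum _; set x3 := zsum _; set x4 := zsum _ => Ear Ebp.
rewrite (_ : _ - _ = (x3 + x4) - (x1 + x2)); last by ring.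
by rewrite (le_trans (ler_normB _ _))// addrC lerD.
Qed.

Lemma zsum_cutoff_cvg f : zsummable f ->
  (fun N => zsum (fun k => cutoff N k * f k)) @ \oo --> zsum f.
Proof.
move=> sf; apply: zsum_dominated_cvg (zsummable_norm sf) _ _ => [N k|k].
  by rewrite normrM (ger0_norm (cutoff_ge0 _ _)) ler_piMl// cutoff_le1.
rewrite -[X in _ --> X]mul1r; apply: cvgM; first exact: cutoff_cvg.
exact: cvg_cst.
Qed.

(** The averages of rho^2 at scale N + 1 stay bounded along some sequence of N
    tending to infinity.  Bounds on the means of the averages give this almost
    surely, by Fatou, but do not give boundedness at all scales. *)
Definition tame rho := exists C, forall n0, exists2 N, (n0 <= N)%N &
  forall n, zseries (fun k => rho k ^+ 2 * poisson_weight N k) n <= C.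

Lemma tame_zl2 rho : tame rho -> zl2 (fun k => (1 + `|k%:~R|)^-1 * rho k).
Proof.
move=> [C /(_ 0%N)[N _ HC]].
have S : zsummable (fun k => rho k ^+ 2 * poisson_weight N k).
  by apply: ge0_zsummable HC => k; rewrite mulr_ge0 ?sqr_ge0 ?poisson_weight_ge0.
apply: zsummable_le (zsummableZ N.+1%:R S) => k.
rewrite ger0_norm ?sqr_ge0// exprMn [leLHS]mulrC [leRHS]mulrCA ler_wpM2l ?sqr_ge0//.
rewrite /poisson_weight; set M : R := N.+1%:R; have M1 : 1 <= M by rewrite ler1n.
have k0 := normr_ge0 (k%:~R : R).
rewrite -[in X in _ <= X](real_normK (num_real (k%:~R : R))).
move: k0; set t := `|_| => t0.
rewrite mulrA ler_pdivlMr; last by nra.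
rewrite exprVn ler_pdivrMl; last by nra.
have : 0 <= (M ^+ 2 - 1) * t ^+ 2 by rewrite mulr_ge0 ?sqr_ge0//; nra.
have : 0 <= M ^+ 2 * t by rewrite mulr_ge0 ?sqr_ge0.
by nra.
Qed.

Lemma tame_weighted_summable rho : tame rho ->
  zsummable (fun k => (1 + k%:~R ^+ 2)^-1 * rho k ^+ 2).
Proof.
move=> /tame_zl2 sr; apply: zsummable_le (zsummableZ 2 sr) => k.
rewrite ger0_norm; last by rewrite mulr_ge0 ?sqr_ge0// invr_ge0 addr_ge0 ?sqr_ge0.
rewrite [in leRHS]exprMn [leRHS]mulrA ler_wpM2r ?sqr_ge0// exprVn.
rewrite -[in leLHS](real_normK (num_real (k%:~R : R))).
have := normr_ge0 (k%:~R : R); move: `|_| => s s0.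
have s1 : 0 < (1 + s) ^+ 2 by nra.
rewrite ler_pdivlMr// ler_pdivrMl; last by nra.
by have := sqr_ge0 (1 - s); nra.
Qed.

Lemma tame_tempered rho g : tame rho -> zl2 g -> tempered (fun k => rho k * g k).
Proof.
move=> /tame_zl2 sr sg; rewrite /tempered; under eq_fun do rewrite mulrA.
exact: zl2_mul.
Qed.

Lemma window_sum_mul rho g N C : zl2 g ->
  (forall n, zseries (fun k => rho k ^+ 2 * poisson_weight N k) n <= C) ->
  window_sum N (fun k => rho k * g k) <= C + zsum (fun k => g k ^+ 2).
Proof.
move=> sg HC.
have S : zl2 (fun k => `|rho k| * root_weight N k).
  rewrite /zl2 (_ : (fun k => _) = (fun k => rho k ^+ 2 * poisson_weight N k)).
    by apply: ge0_zsummable HC => k; rewrite mulr_ge0 ?sqr_ge0 ?poisson_weight_ge0.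
  by apply/funext => k; rewrite exprMn root_weight_sqr real_normK ?num_real.
have SC : zsum (fun k => (`|rho k| * root_weight N k) ^+ 2) <= C.
  apply: zsum_le => // n; rewrite (le_trans _ (HC n))//.
  by apply: le_zseries => k; rewrite exprMn root_weight_sqr real_normK ?num_real.
rewrite (le_trans _ (lerD SC (lexx _)))//.
rewrite -zsumD//; apply: ler_zsum.
- apply: (@zsummable_le _ _ (fun k => (`|rho k| * root_weight N k) * `|g k|)).
    move=> k; rewrite ger0_norm ?mulr_ge0 ?root_weight_ge0// normrM.
    by rewrite mulrAC.
  by apply: zl2_mul => //; exact: zl2_norm.
- exact: zsummableD.
- move=> k; rewrite normrM -(real_normK (num_real (g k))).
  have := sqr_ge0 (`|rho k| * root_weight N k - `|g k|).
  have : 0 <= (`|rho k| * root_weight N k) * `|g k| by rewrite !mulr_ge0 ?root_weight_ge0.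
  nra.
Qed.

(** Real and imaginary parts of Pi Lambda Pi (a + i b). *)
Definition comp_re rho a b := proj_re (fun k => rho k * proj_re a b k) (fun k => rho k * proj_im a b k).
Definition comp_im rho a b := proj_im (fun k => rho k * proj_re a b k) (fun k => rho k * proj_im a b k).

Lemma sum4_ge (C s1 s2 s3 s4 : R) : 0 <= s1 -> 0 <= s2 -> 0 <= s3 -> 0 <= s4 ->
  [/\ C + s1 <= C + s1 + s2 + s3 + s4, C + s2 <= C + s1 + s2 + s3 + s4,
      C + s3 <= C + s1 + s2 + s3 + s4 & C + s4 <= C + s1 + s2 + s3 + s4].
Proof. by move=> *; split; lra. Qed.

Lemma sum_errors_le (y1 y2 y3 y4 wa wb wc wd v1 v2 v3 v4 B e : R) :
  y1 < e / 3 -> y3 < e / 3 -> y2 <= 2 * wa * v1 + 2 * wb * v2 ->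
  y4 <= 2 * wc * v3 + 2 * wd * v4 ->
  2 * (wa + wb + wc + wd) * B < e / 3 ->
  2 * wa * v1 <= 2 * wa * B -> 2 * wb * v2 <= 2 * wb * B ->
  2 * wc * v3 <= 2 * wc * B -> 2 * wd * v4 <= 2 * wd * B ->
  y1 + y2 + (y3 + y4) <= e.
Proof. by move=> *; lra. Qed.

(** Both sides, cut off at scale N, are close to the same symmetric expression by
    [proj_cutoff]: in its error bound the window sums of a, b, c and d tend to 0
    and those of rho times the projections are bounded at the good scales. *)
Lemma comp_symmetric rho a b c d : tame rho ->
  zl2 a -> zl2 b -> zl2 c -> zl2 d ->
  zl2 (comp_re rho a b) -> zl2 (comp_im rho a b) ->
  zl2 (comp_re rho c d) -> zl2 (comp_im rho c d) ->
  zsum (fun k => a k * comp_re rho c d k + b k * comp_im rho c d k) =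
  zsum (fun k => c k * comp_re rho a b k + d k * comp_im rho a b k).
Proof.
move=> trho sa sb sc sd sab1 sab2 scd1 scd2.
set X := LHS; set Y := RHS.
have sX : zsummable (fun k => a k * comp_re rho c d k + b k * comp_im rho c d k).
  by apply: zsummableD; exact: zl2_mul.
have sY : zsummable (fun k => c k * comp_re rho a b k + d k * comp_im rho a b k).
  by apply: zsummableD; exact: zl2_mul.
have cX := zsum_cutoff_cvg sX; have cY := zsum_cutoff_cvg sY.
have sf := zl2_proj_re sa sb; have sf' := zl2_proj_im sa sb.
have sg := zl2_proj_re sc sd; have sg' := zl2_proj_im sc sd.
have [C HC] := trho.
have tm g (sg0 : zl2 g) := tame_tempered trho sg0.
pose B := C + zsum (fun k => proj_re a b k ^+ 2) + zsum (fun k => proj_im a b k ^+ 2)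
  + zsum (fun k => proj_re c d k ^+ 2) + zsum (fun k => proj_im c d k ^+ 2).
pose W N : R := window_sum N a + window_sum N b + window_sum N c + window_sum N d.
have cW : 2 * W N * B @[N --> \oo] --> 0.
  rewrite -[X in _ --> X](mul0r B); apply: cvgM; last exact: cvg_cst.
  rewrite -[X in _ --> X](mulr0 2); apply: cvgM; first exact: cvg_cst.
  rewrite -[X in _ --> X](addr0 0) -[X in _ --> X + _](addr0 0) -[X in _ --> X + _ + _](addr0 0).
  by do 3 (apply: cvgD; last exact: window_sum_cvg0); exact: window_sum_cvg0.
apply/eqP; rewrite -subr_eq0 -normr_eq0; apply/eqP/le_anti; rewrite normr_ge0 andbT.
apply/ler_addgt0Pr => e e0; rewrite add0r.
have e3 : 0 < e / 3 by rewrite divr_gt0.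
have [n1 _ H1] := (cvgrPdist_lt _ _).1 cX _ e3.
have [n2 _ H2] := (cvgrPdist_lt _ _).1 cY _ e3.
have [n3 _ H3] := (cvgrPdist_lt _ _).1 cW _ e3.
have [N nN HN] := HC (maxn n1 (maxn n2 n3)).
move: nN; rewrite !geq_max => /and3P[/H1 {}H1 /H2 {}H2 /H3 {}H3].
have Wf g : zl2 g -> 0 <= window_sum N (fun k => rho k * g k) <= C + zsum (fun k => g k ^+ 2).
  by move=> sg0; rewrite window_sum_mul// andbT window_sum_ge0//; exact/zsummable_window/tm.
have Wp g : zl2 g -> 0 <= window_sum N g.
  by move=> sg0; apply: window_sum_ge0; exact/zsummable_window/zl2_tempered.
have K1 := proj_cutoff N sa sb (tm _ sg) (tm _ sg').
have K2 := proj_cutoff N sc sd (tm _ sf) (tm _ sf').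
have E : zsum (fun k => cutoff N k *
     (proj_re a b k * (rho k * proj_re c d k) + proj_im a b k * (rho k * proj_im c d k))) =
   zsum (fun k => cutoff N k *
     (proj_re c d k * (rho k * proj_re a b k) + proj_im c d k * (rho k * proj_im a b k))).
  by congr zsum; apply/funext => k; ring.
rewrite E in K1.
have Wle u g : zl2 u -> zl2 g -> C + zsum (fun k => g k ^+ 2) <= B ->
    2 * window_sum N u * window_sum N (fun k => rho k * g k) <= 2 * window_sum N u * B.
  move=> su sg0 gB; have /andP[_ h] := Wf _ sg0.
  by rewrite ler_wpM2l ?mulr_ge0 ?Wp// (le_trans h).
have [] := @sum4_ge C _ _ _ _ (zsum_sqr_ge0 sf) (zsum_sqr_ge0 sf') (zsum_sqr_ge0 sg) (zsum_sqr_ge0 sg').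
rewrite -/B => B1 B2 B3 B4.
have {}B1 := Wle d _ sd sf B1.
have {}B2 := Wle c _ sc sf' B2.
have {}B3 := Wle b _ sb sg B3.
have {}B4 := Wle a _ sa sg' B4.
move: H1 H2 H3 K1 K2; rewrite -/(comp_re rho c d) -/(comp_im rho c d)
  -/(comp_re rho a b) -/(comp_im rho a b) sub0r normrN.
set XN := zsum (fun k => cutoff N k * (a k * _ + _)).
set YN := zsum (fun k => cutoff N k * (c k * _ + _)).
set Z := zsum (fun k => cutoff N k * (proj_re c d k * _ + _)) => H1 H2 H3 K1 K2.
have {}H3 := le_lt_trans (ler_norm _) H3.
rewrite (_ : X - Y = (X - XN) + (XN - Z) - ((Y - YN) + (YN - Z))); last by ring.
rewrite (le_trans (ler_normB _ _))//.
rewrite (le_trans (lerD (ler_normD _ _) (ler_normD _ _)))//.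
exact: (sum_errors_le H1 H2 K1 K2 H3 B4 B3 B2 B1).
Qed.

End RealProjection.

(** * Self-adjointness of the compressed operator *)

Section SelfAdjoint.
Context {R : realType}.
Local Notation C := R[i].
Implicit Types (u v w z f g : int -> C) (rho : int -> R) (k l m : int).

Definition re_part v k : R := complex.Re (v k).
Definition im_part v k : R := complex.Im (v k).

Lemma complexE v k : v k = Complex (re_part v k) (im_part v k).
Proof. by rewrite /re_part /im_part; case: (v k). Qed.

Lemma l2norm_integrandE v k :
  Normc.normc (v k) ^+ 2 = re_part v k ^+ 2 + im_part v k ^+ 2 :> R.
Proof.
rewrite /re_part /im_part; case: (v k) => a b /=.
by rewrite sqr_sqrtr// addr_ge0// sqr_ge0.
Qed.

Lemma ell2P v : ell2 v <-> zl2 (re_part v) /\ zl2 (im_part v).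
Proof.
have ge0 k : 0 <= Normc.normc (v k) ^+ 2 by rewrite sqr_ge0.
split => [/lty_poweRy h|[sr si]].
  have : zsummable (fun k => Normc.normc (v k) ^+ 2).
    by apply/esum_ltoo => //; apply: h; rewrite invr_eq0.
  by move=> sv; split; apply: zsummable_le sv => k;
    rewrite ger0_norm ?sqr_ge0// l2norm_integrandE ?lerDl ?lerDr sqr_ge0.
apply: poweR_lty; apply/esum_ltoo => //.
by under eq_fun do rewrite l2norm_integrandE; exact: zsummableD.
Qed.

Lemma l2norm_lt v (e : R) : 0 < e -> zl2 (re_part v) -> zl2 (im_part v) ->
  zsum (fun k => re_part v k ^+ 2) + zsum (fun k => im_part v k ^+ 2) < e ^+ 2 ->
  (l2norm v < e%:E)%E.
Proof.
move=> e0 sr si h; rewrite /l2norm esum_zsum => [|k|]; last 2 first.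
- exact: sqr_ge0.
- by under eq_fun do rewrite l2norm_integrandE; exact: zsummableD.
under eq_fun do rewrite l2norm_integrandE; rewrite zsumD//.
have h0 := addr_ge0 (zsum_sqr_ge0 sr) (zsum_sqr_ge0 si).
rewrite poweR_EFin lte_fin powR12_sqrt//.
by rewrite -(ltr_pXn2r (n := 2)) ?nnegrE ?sqrtr_ge0 ?(ltW e0)// sqr_sqrtr.
Qed.

Definition csummable f := zsummable (re_part f) /\ zsummable (im_part f).

Lemma sumZE f : csummable f -> sumZ f = Complex (zsum (re_part f)) (zsum (im_part f)).
Proof. by move=> [sr si]; rewrite /sumZ !sumZ_realE. Qed.

Lemma re_partD f g k : re_part (fun k => f k + g k) k = re_part f k + re_part g k.
Proof. by rewrite /re_part; case: (f k) (g k) => [? ?] [? ?]. Qed.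
Lemma im_partD f g k : im_part (fun k => f k + g k) k = im_part f k + im_part g k.
Proof. by rewrite /im_part; case: (f k) (g k) => [? ?] [? ?]. Qed.
Lemma re_partM f g k : re_part (fun k => f k * g k) k =
  re_part f k * re_part g k - im_part f k * im_part g k.
Proof. by rewrite /re_part /im_part; case: (f k) (g k) => [? ?] [? ?]. Qed.
Lemma im_partM f g k : im_part (fun k => f k * g k) k =
  re_part f k * im_part g k + im_part f k * re_part g k.
Proof. by rewrite /re_part /im_part; case: (f k) (g k) => [? ?] [? ?]. Qed.
Lemma re_partJ f k : re_part (fun k => conjc (f k)) k = re_part f k.
Proof. by rewrite /re_part; case: (f k). Qed.
Lemma im_partJ f k : im_part (fun k => conjc (f k)) k = - im_part f k.
Proof. by rewrite /im_part; case: (f k). Qed.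

Definition part_simp := (re_partD, im_partD, re_partM, im_partM, re_partJ, im_partJ).

Lemma re_part_comb (a b : R) f g : re_part (fun k => Complex a b * f k + g k) =
  fun k => a * re_part f k - b * im_part f k + re_part g k.
Proof. by apply/funext => k; rewrite !part_simp. Qed.
Lemma im_part_comb (a b : R) f g : im_part (fun k => Complex a b * f k + g k) =
  fun k => a * im_part f k + b * re_part f k + im_part g k.
Proof. by apply/funext => k; rewrite !part_simp. Qed.

Lemma csummable_comb (a : C) f g : csummable f -> csummable g ->
  csummable (fun k => a * f k + g k).
Proof.
case: a => a b [fr fi] [gr gi]; split.
- rewrite re_part_comb.
  by apply: zsummableD => //; apply: zsummableB; exact: zsummableZ.
- rewrite im_part_comb.
  by apply: zsummableD => //; apply: zsummableD; exact: zsummableZ.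
Qed.

Lemma sumZ_comb (a : C) f g : csummable f -> csummable g ->
  sumZ (fun k => a * f k + g k) = a * sumZ f + sumZ g.
Proof.
move=> sf sg; rewrite !sumZE//; last exact: csummable_comb.
case: sf sg => fr fi [gr gi]; case: a => a b.
rewrite re_part_comb.
rewrite im_part_comb.
have Z c (h : int -> R) (sh : zsummable h) := zsummableZ c sh.
rewrite zsumD//; last by apply: zsummableB; exact: Z.
rewrite zsumB; [|exact: Z..].
rewrite zsumD//; last by apply: zsummableD; exact: Z.
by rewrite zsumD; [|exact: Z..]; rewrite !zsumZ//.
Qed.

Definition ctempered v := tempered (re_part v) /\ tempered (im_part v).

Lemma ell2_ctempered v : ell2 v -> ctempered v.
Proof. by move=> /ell2P[? ?]; split; exact: zl2_tempered. Qed.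

Lemma Pi_entryE k l : Pi_entry k l = Complex ((l == k)%:R * 2^-1) (hilbert_kernel (k - l)) :> C.
Proof.
rewrite /Pi_entry /hilbert_kernel eq_sym; case: eqP => [->|_].
  by rewrite subrr dvdz0 mul1r.
by rewrite mul0r; case: ifP.
Qed.

Lemma Pi_summand v k : ctempered v ->
  [/\ csummable (fun l => Pi_entry k l * v l),
   zsum (re_part (fun l => Pi_entry k l * v l)) = proj_re (re_part v) (im_part v) k &
   zsum (im_part (fun l => Pi_entry k l * v l)) = proj_im (re_part v) (im_part v) k].
Proof.
move=> [tr ti].
have [Dr dr] := zsum_delta k (re_part v); have [Di di] := zsum_delta k (im_part v).
have Hr := zsummable_hilbert k tr; have Hi := zsummable_hilbert k ti.
have Er : re_part (fun l => Pi_entry k l * v l) = fun l =>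
    2^-1 * ((l == k)%:R * re_part v l) - hilbert_kernel (k - l) * im_part v l.
  apply/funext => l; rewrite !part_simp /re_part /im_part Pi_entryE/=.
  by ring.
have Ei : im_part (fun l => Pi_entry k l * v l) = fun l =>
    2^-1 * ((l == k)%:R * im_part v l) + hilbert_kernel (k - l) * re_part v l.
  apply/funext => l; rewrite !part_simp /re_part /im_part Pi_entryE/=.
  by ring.
rewrite /csummable Er Ei; split.
- by split; [apply: zsummableB|apply: zsummableD] => //; exact: zsummableZ.
- rewrite zsumB//; last exact: zsummableZ.
  by rewrite zsumZ// dr mulrC.
- rewrite zsumD//; last exact: zsummableZ.
  by rewrite zsumZ// di mulrC.
Qed.

Lemma Pi_opE v k : ctempered v -> Pi_op v k =
  Complex (proj_re (re_part v) (im_part v) k) (proj_im (re_part v) (im_part v) k).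
Proof.
move=> /(Pi_summand k)[cs rs is_].
by rewrite /Pi_op sumZE// rs is_.
Qed.

Lemma re_Pi_op v : ctempered v -> re_part (Pi_op v) = proj_re (re_part v) (im_part v).
Proof. by move=> tv; apply/funext => k; rewrite /re_part Pi_opE. Qed.
Lemma im_Pi_op v : ctempered v -> im_part (Pi_op v) = proj_im (re_part v) (im_part v).
Proof. by move=> tv; apply/funext => k; rewrite /im_part Pi_opE. Qed.

Lemma ell2_Pi_op v : ell2 v -> ell2 (Pi_op v).
Proof.
move=> v2; have tv := ell2_ctempered v2; move/ell2P: v2 => [sr si].
apply/ell2P; rewrite re_Pi_op// im_Pi_op//.
by split; [exact: zl2_proj_re|exact: zl2_proj_im].
Qed.

Lemma Pi_op_comb (a : C) u v : ctempered u -> ctempered v ->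
  Pi_op (seq_comb a u v) = seq_comb a (Pi_op u) (Pi_op v).
Proof.
move=> tu tv; apply/funext => k; rewrite /seq_comb /Pi_op.
have [su _ _] := Pi_summand k tu; have [sv _ _] := Pi_summand k tv.
by rewrite -sumZ_comb//; congr sumZ; apply/funext => l; rewrite mulrDr mulrCA.
Qed.

Lemma ell2_comb (a : C) u v : ell2 u -> ell2 v -> ell2 (seq_comb a u v).
Proof.
case: a => a b /ell2P[ur ui] /ell2P[vr vi]; apply/ell2P; split.
- rewrite re_part_comb.
  by apply: zl2D => //; apply: zl2B; exact: zl2Z.
- rewrite im_part_comb.
  by apply: zl2D => //; apply: zl2D; exact: zl2Z.
Qed.

Lemma re_Lambda rho v k : re_part (Lambda_op rho v) k = rho k * re_part v k.
Proof.
rewrite /re_part /Lambda_op; case: (v k) => a b /=; by rewrite mul0r subr0.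
Qed.
Lemma im_Lambda rho v k : im_part (Lambda_op rho v) k = rho k * im_part v k.
Proof.
rewrite /im_part /Lambda_op; case: (v k) => a b /=; by rewrite mul0r addr0.
Qed.

Lemma ctempered_Lambda rho v : tame rho -> ell2 v -> ctempered (Lambda_op rho v).
Proof.
move=> tr /ell2P[sr si]; split.
- rewrite (_ : re_part _ = fun k => rho k * re_part v k); first exact: tame_tempered.
  by apply/funext => k; rewrite re_Lambda.
- rewrite (_ : im_part _ = fun k => rho k * im_part v k); first exact: tame_tempered.
  by apply/funext => k; rewrite im_Lambda.
Qed.

Lemma Delta_parts rho v : tame rho -> ell2 v ->
  re_part (Delta_op rho v) = comp_re rho (re_part v) (im_part v) /\
  im_part (Delta_op rho v) = comp_im rho (re_part v) (im_part v).
Proof.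
move=> tr v2; have tv := ell2_ctempered v2; have p2 := ell2_Pi_op v2.
have tl := ctempered_Lambda tr p2.
rewrite /Delta_op re_Pi_op// im_Pi_op//.
rewrite (_ : re_part (Lambda_op _ _) = fun k => rho k * proj_re (re_part v) (im_part v) k); last first.
  by apply/funext => k; rewrite re_Lambda re_Pi_op.
rewrite (_ : im_part (Lambda_op _ _) = fun k => rho k * proj_im (re_part v) (im_part v) k)//.
by apply/funext => k; rewrite im_Lambda im_Pi_op.
Qed.

Lemma Delta_op_comb rho (a : C) u v : tame rho -> ell2 u -> ell2 v ->
  Delta_op rho (seq_comb a u v) = seq_comb a (Delta_op rho u) (Delta_op rho v).
Proof.
move=> tr u2 v2; rewrite /Delta_op Pi_op_comb; [|exact: ell2_ctempered..].
have L w (w2 : ell2 w) := ctempered_Lambda tr (ell2_Pi_op w2).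
rewrite -(Pi_op_comb a (L _ u2) (L _ v2)).
congr Pi_op; apply/funext => k; rewrite /Lambda_op /seq_comb.
by rewrite mulrDr mulrCA.
Qed.

Lemma l2dotE u v : ell2 u -> ell2 v -> l2dot u v = Complex
  (zsum (fun k => re_part u k * re_part v k + im_part u k * im_part v k))
  (zsum (fun k => re_part u k * im_part v k - im_part u k * re_part v k)).
Proof.
move=> /ell2P[ur ui] /ell2P[vr vi].
have Er : re_part (fun k => conjc (u k) * v k) =
    fun k => re_part u k * re_part v k + im_part u k * im_part v k.
  by apply/funext => k; rewrite !part_simp mulNr opprK.
have Ei : im_part (fun k => conjc (u k) * v k) =
    fun k => re_part u k * im_part v k - im_part u k * re_part v k.
  by apply/funext => k; rewrite !part_simp mulNr.
rewrite /l2dot sumZE ?Er ?Ei// /csummable Er Ei.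
by split; [apply: zsummableD|apply: zsummableB]; exact: zl2_mul.
Qed.

(** The imaginary part of the inner product is its real part after multiplying v by
    - i, that is after replacing (Re v, Im v) with (Im v, - Re v). *)
Lemma Pi_op_symmetric u v : ell2 u -> ell2 v -> l2dot u (Pi_op v) = l2dot (Pi_op u) v.
Proof.
move=> u2 v2; have tu := ell2_ctempered u2; have tv := ell2_ctempered v2.
rewrite !l2dotE//; try exact: ell2_Pi_op.
rewrite !re_Pi_op// !im_Pi_op//.
move/ell2P: u2 => [ur ui]; move/ell2P: v2 => [vr vi].
congr Complex; first exact: proj_symmetric.
have := proj_symmetric ur ui vi (zl2N vr).
have E k : proj_re (im_part v) (fun k => - re_part v k) k = proj_im (re_part v) (im_part v) k.
  by rewrite /proj_re /proj_im hilbertN ?opprK//; exact: zl2_tempered.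
have E' k : proj_im (im_part v) (fun k => - re_part v k) k = - proj_re (re_part v) (im_part v) k.
  by rewrite /proj_re /proj_im opprB addrC mulNr.
under eq_fun do rewrite E E' mulrN.
by under [in X in _ = X -> _]eq_fun do rewrite mulrN.
Qed.

Lemma Delta_domP rho v : Delta_dom rho v <-> ell2 v /\ ell2 (Delta_op rho v).
Proof. by []. Qed.

Lemma Delta_op_symmetric rho u v : tame rho ->
  Delta_dom rho u -> Delta_dom rho v ->
  l2dot u (Delta_op rho v) = l2dot (Delta_op rho u) v.
Proof.
move=> tr /Delta_domP[u2 Du2] /Delta_domP[v2 Dv2].
have [rv iv] := Delta_parts tr v2; have [ru iu] := Delta_parts tr u2.
have /ell2P := Du2; rewrite ru iu => -[sru siu].
have /ell2P := Dv2; rewrite rv iv => -[srv siv].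
rewrite [LHS](l2dotE u2 Dv2).
rewrite [RHS](l2dotE Du2 v2).
rewrite rv.
rewrite iv.
rewrite ru.
rewrite iu.
move/ell2P: u2 => [ur ui]; move/ell2P: v2 => [vr vi].
congr Complex.
  rewrite comp_symmetric//; congr zsum; apply/funext => k.
  by rewrite mulrC [X in _ + X]mulrC.
(* multiplying v by - i turns the real part of the inner product into its
   imaginary part *)
have Er : proj_re (im_part v) (fun k => - re_part v k) = proj_im (re_part v) (im_part v).
  by apply/funext => k; rewrite /proj_re /proj_im hilbertN ?opprK//; exact: zl2_tempered.
have Ei : proj_im (im_part v) (fun k => - re_part v k) =
    fun k => - proj_re (re_part v) (im_part v) k.
  by apply/funext => k; rewrite /proj_re /proj_im opprB addrC mulNr.
have tre := tame_tempered tr (zl2_proj_re vr vi).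
have Er2 : comp_re rho (im_part v) (fun k => - re_part v k) = comp_im rho (re_part v) (im_part v).
  rewrite /comp_re /comp_im Er Ei; apply/funext => k; rewrite /proj_re /proj_im.
  by under eq_fun do rewrite mulrN; rewrite hilbertN// opprK.
have Ei2 : comp_im rho (im_part v) (fun k => - re_part v k) =
    fun k => - comp_re rho (re_part v) (im_part v) k.
  rewrite /comp_re /comp_im Er Ei; apply/funext => k; rewrite /proj_re /proj_im.
  by ring.
have := @comp_symmetric _ rho (re_part u) (im_part u) (im_part v) (fun k => - re_part v k) tr
  ur ui vi (zl2N vr) sru siu.
rewrite Er2 Ei2 => /(_ siv (zl2N srv)).
under eq_fun do rewrite mulrN; move=> ->; congr zsum; apply/funext => k.
by rewrite mulNr mulrC [in X in _ - X]mulrC.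
Qed.

Definition basis_vec m : int -> C := fun k => Complex (k == m)%:R 0.

Lemma sumZ_basis f m : sumZ (fun k => f k * basis_vec m k) = f m.
Proof.
have Er : re_part (fun k => f k * basis_vec m k) = fun k => (k == m)%:R * re_part f k.
  by apply/funext => k; rewrite !part_simp /re_part /im_part /=; ring.
have Ei : im_part (fun k => f k * basis_vec m k) = fun k => (k == m)%:R * im_part f k.
  by apply/funext => k; rewrite !part_simp /re_part /im_part /=; ring.
have [Sr sr] := zsum_delta m (re_part f); have [Si si] := zsum_delta m (im_part f).
by rewrite sumZE /csummable ?Er ?Ei// sr si -complexE.
Qed.

Lemma ell2_basis m : ell2 (basis_vec m).
Proof.
have [S _] := @zsum_delta R m (fun=> 1).
apply/ell2P; split.
  apply: zsummable_zl2; rewrite (_ : re_part _ = fun k => (k == m)%:R * 1)//.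
  by apply/funext => k; rewrite mulr1.
rewrite (_ : im_part _ = fun=> 0)//; apply: zsummable_zl2.
by apply: zsummable_le (zsummable_norm S) => k; rewrite normr0.
Qed.

Lemma Pi_op_basis m k : Pi_op (basis_vec m) k = Pi_entry k m.
Proof. exact: sumZ_basis. Qed.

(** Column m of Pi is O(1/|k|), and rho_k / (1 + |k|) is square summable. *)
Lemma ell2_Lambda_Pi_basis rho m : tame rho ->
  ell2 (Lambda_op rho (Pi_op (basis_vec m))).
Proof.
move=> tr; have zr := tame_zl2 tr.
have B k : `|rho k * hilbert_kernel (k - m)| <=
    (1 + `|m%:~R|) * `|(1 + `|k%:~R|)^-1 * rho k|.
  rewrite !normrM normfV (ger0_norm (addr_ge0 _ _))// mulrA mulrC ler_wpM2r//.
  by rewrite -normrN -hilbert_kernelN opprB norm_hilbert_kernel_shift.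
apply/ell2P; split.
- have [S _] := zsum_delta m (fun k => rho k / 2).
  rewrite (_ : re_part _ = fun k => (k == m)%:R * (rho k / 2)); first exact: zsummable_zl2.
  apply/funext => k; rewrite re_Lambda /re_part Pi_op_basis Pi_entryE/= eq_sym.
  by ring.
- rewrite (_ : im_part _ = fun k => rho k * hilbert_kernel (k - m)).
    by apply: zl2_le B _; apply: zl2Z; exact: zl2_norm.
  by apply/funext => k; rewrite im_Lambda /im_part Pi_op_basis Pi_entryE.
Qed.

Lemma Delta_dom_basis rho m : tame rho -> Delta_dom rho (basis_vec m).
Proof.
move=> tr; apply/Delta_domP; split; first exact: ell2_basis.
exact: ell2_Pi_op (ell2_Lambda_Pi_basis m tr).
Qed.

Lemma Delta_dom_comb rho (a : C) u v : tame rho ->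
  Delta_dom rho u -> Delta_dom rho v -> Delta_dom rho (seq_comb a u v).
Proof.
move=> tr /Delta_domP[u2 Du] /Delta_domP[v2 Dv]; apply/Delta_domP.
split; first exact: ell2_comb.
by rewrite (Delta_op_comb a tr u2 v2); exact: ell2_comb.
Qed.

Lemma Delta_dom0 rho : tame rho -> Delta_dom rho (fun=> 0).
Proof.
move=> tr; have D := Delta_dom_basis 0 tr.
rewrite (_ : (fun=> 0) = seq_comb (- 1) (basis_vec 0) (basis_vec 0)).
  exact: (Delta_dom_comb _ tr D D).
by apply/funext => k; rewrite /seq_comb mulN1r addNr.
Qed.

Definition ctrunc n v : int -> C := fun k => if zwin n k then v k else 0.

Lemma Delta_dom_trunc rho n v : tame rho -> Delta_dom rho (ctrunc n v).
Proof.
move=> tr; elim: n => [|n IH].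
  rewrite (_ : ctrunc 0 v = fun=> 0); first exact: Delta_dom0.
  by apply/funext => -[].
rewrite (_ : ctrunc n.+1 v = seq_comb (v (Posz n)) (basis_vec (Posz n))
    (seq_comb (v (Negz n)) (basis_vec (Negz n)) (ctrunc n v))).
  have B m := Delta_dom_basis m tr.
  exact: (Delta_dom_comb _ tr (B _) (Delta_dom_comb _ tr (B _) IH)).
have mulb (x : C) (b : bool) : x * Complex b%:R 0 = if b then x else 0.
  by case: b; [exact: mulr1|exact: mulr0].
apply/funext => -[] i; rewrite /seq_comb /ctrunc /basis_vec !mulb /= ltnS leq_eqVlt /eq_op/= /eq_op/=.
  by rewrite -[eqn i n]/(i == n) add0r; case: eqVneq => [->|_]/=; rewrite ?ltnn ?addr0 ?add0r.
by rewrite -[eqn i n]/(i == n) add0r; case: eqVneq => [->|_]/=; rewrite ?ltnn ?addr0 ?add0r.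
Qed.

Lemma Delta_dom_dense rho : tame rho -> dense_in_ell2 (Delta_dom rho).
Proof.
move=> tr v /ell2P[sr si] e e0.
have e2 : 0 < e ^+ 2 / 2 by rewrite divr_gt0 ?exprn_gt0.
have [n1 _ H1] := (cvgrPdist_lt _ _).1 (zsum_cvg sr) _ e2.
have [n2 _ H2] := (cvgrPdist_lt _ _).1 (zsum_cvg si) _ e2.
set n := maxn n1 n2.
have {}H1 := H1 n (leq_maxl _ _); have {}H2 := H2 n (leq_maxr _ _).
exists (ctrunc n v); first exact: Delta_dom_trunc.
have tail (f : int -> R) : zl2 f -> zl2 (fun k => f k - ztrunc n f k) /\
    zsum (fun k => (f k - ztrunc n f k) ^+ 2) = zsum (fun k => f k ^+ 2) -
      zseries (fun k => f k ^+ 2) n.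
  move=> sf; have E : (fun k => (f k - ztrunc n f k) ^+ 2) =
      fun k => f k ^+ 2 - ztrunc n (fun k => f k ^+ 2) k.
    apply/funext => k; rewrite /ztrunc; case: ifP => _; last by rewrite !subr0.
    by rewrite !subrr expr0n.
  have S := zsummable_trunc n (fun k => f k ^+ 2).
  rewrite /zl2 E; split; first exact: zsummableB.
  by rewrite zsumB// zsum_trunc.
have Er : re_part (fun k => v k - ctrunc n v k) = fun k => re_part v k - ztrunc n (re_part v) k.
  apply/funext => k; rewrite /re_part /ctrunc /ztrunc; case: ifP => _; case: (v k) => //=.
have Ei : im_part (fun k => v k - ctrunc n v k) = fun k => im_part v k - ztrunc n (im_part v) k.
  apply/funext => k; rewrite /im_part /ctrunc /ztrunc; case: ifP => _; case: (v k) => //=.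
have [tr1 tr2] := tail _ sr; have [ti1 ti2] := tail _ si.
apply: l2norm_lt => //; first by rewrite Er.
  by rewrite Ei.
rewrite Er Ei tr2 ti2 [ltRHS]splitr ltrD//.
- exact: le_lt_trans (ler_norm _) H1.
- exact: le_lt_trans (ler_norm _) H2.
Qed.

Lemma conjc_sumZ f : csummable f -> conjc (sumZ f) = sumZ (fun k => conjc (f k)).
Proof.
move=> sf; have Er : re_part (fun k => conjc (f k)) = re_part f.
  by apply/funext => k; rewrite re_partJ.
have Ei : im_part (fun k => conjc (f k)) = fun k => - im_part f k.
  by apply/funext => k; rewrite im_partJ.
case: (sf) => fr fi; rewrite !sumZE//; last first.
  by rewrite /csummable Er Ei; split => //; exact: zsummableN.
by rewrite Er Ei zsumN.
Qed.

Lemma conjc_Pi_entry k l : conjc (Pi_entry k l) = Pi_entry l k :> C.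
Proof.
rewrite !Pi_entryE /=; congr Complex; first by rewrite eq_sym.
by rewrite -hilbert_kernelN opprB.
Qed.

(** Here Lambda Pi e_m is square summable, so Pi moves to the left without any
    regularization. *)
Lemma l2dot_Delta_basis rho w m : tame rho -> ell2 w ->
  l2dot w (Delta_op rho (basis_vec m)) = conjc (Delta_op rho w m).
Proof.
move=> tr w2; have L2 := ell2_Lambda_Pi_basis m tr.
rewrite /Delta_op (Pi_op_symmetric w2 L2).
have [cs _ _] := Pi_summand m (ctempered_Lambda tr (ell2_Pi_op w2)).
rewrite [in RHS]/Pi_op (conjc_sumZ cs) /l2dot; congr sumZ; apply/funext => k.
rewrite /Lambda_op Pi_op_basis !rmorphM/= conjc_Pi_entry oppr0.
by rewrite mulrCA mulrC -mulrA [in RHS]mulrC -[in RHS]mulrA mulrA [in RHS]mulrC.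
Qed.

(** Symmetry on the maximal domain makes the adjoint an extension of the operator.
    It is no larger, because testing against the basis vectors already determines
    the image of w coordinate by coordinate. *)
Theorem Delta_self_adjoint rho : tame rho ->
  self_adjoint (Delta_dom rho) (Delta_op rho).
Proof.
move=> tr; split.
- by move=> v [].
- by move=> v [].
- split; first exact: Delta_dom0.
  + by move=> a u v; exact: Delta_dom_comb.
  + by move=> a u v [u2 _] [v2 _]; exact: Delta_op_comb.
- exact: Delta_dom_dense.
- move=> w z; split => [[w2 z2 adj]|[Dw <-]]; last first.
    have /Delta_domP[w2 Aw2] := Dw.
    by split => // v Dv; exact: Delta_op_symmetric.
  have E : Delta_op rho w = z.
    apply/funext => m; apply: (can_inj (@conjcK R)).
    rewrite -(l2dot_Delta_basis m tr w2) (adj _ (Delta_dom_basis m tr)).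
    exact: (sumZ_basis (fun k => conjc (z k))).
  by split => //; apply/Delta_domP; rewrite E.
Qed.

End SelfAdjoint.

(** * Orthogonality of random phases *)

Section RandomPhase.
Context {R : realType}.
Implicit Types (c x : R).

Definition wave c x : R := cos (2 * pi * (x + c)).

Lemma sin_2pi_shift x : sin (2 * pi * (x + 1)) = sin (2 * pi * x) :> R.
Proof.
by rewrite mulrDr mulr1 sinD mulr_natl cos2pi sin2pi mulr0 addr0 mulr1.
Qed.

Lemma is_derive_wave c x :
  is_derive x (1 : R) (fun x => x + (2 * pi)^-1 * sin (2 * pi * (x + c))) (1 + wave c x).
Proof.
have p0 : 2 * pi != 0 :> R by rewrite mulf_neq0 ?gt_eqF ?pi_gt0.
have d1 : is_derive x (1 : R) (fun x => 2 * pi * (x + c)) (2 * pi).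
  have := @is_deriveZ R R R (fun x => x + c) (2 * pi) x 1 1 _.
  rewrite /GRing.scale/= mulr1; apply.
  by rewrite -[X in is_derive _ _ _ X]addr0; apply: is_deriveD.
have d2 := is_derive1_comp (is_derive_sin _) d1.
have d3 := is_deriveD (is_derive_id x (1 : R)) (is_deriveZ (2 * pi)^-1 d2).
by apply: is_derive_eq d3 _; rewrite /GRing.scale/= /wave mulrCA mulVf// mulr1.
Qed.

Lemma continuous_wave c : continuous (wave c).
Proof.
move=> x; apply: continuous_comp; last exact: continuous_cos.
apply: cvgM; first exact: cvg_cst.
by apply: cvgD; [exact: cvg_id|exact: cvg_cst].
Qed.

Lemma measurable_wave c : measurable_fun [set: R] (wave c).
Proof. exact: continuous_measurable_fun (@continuous_wave c). Qed.

Lemma wave_ge c x : 0 <= 1 + wave c x.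
Proof. by have := cos_geN1 (2 * pi * (x + c)); rewrite /wave; lra. Qed.

Lemma wave_le c x : `|wave c x| <= 1.
Proof. by rewrite ler_norml /wave cos_geN1 cos_le1. Qed.

Local Notation unif := (uniform_prob (@ltr01 R)).

Lemma integral_wave c : (\int[unif]_x (1 + wave c x)%:E = 1)%E.
Proof.
have cw : continuous (fun x => 1 + wave c x).
  by move=> x; apply: cvgD; [exact: cvg_cst|exact: continuous_wave].
rewrite integral_uniform//=; last 2 first.
- by apply/measurable_EFinP; exact: continuous_measurable_fun.
- by move=> x; rewrite lee_fin wave_ge.
pose F x := x + (2 * pi)^-1 * sin (2 * pi * (x + c)).
have cF : continuous F.
  move=> x; apply: differentiable_continuous; apply/derivable1_diffP.
  by have [] := is_derive_wave c x.
rewrite (@continuous_FTC2 _ _ F)//.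
- rewrite -EFinB -EFinM /F add0r [1 + c]addrC sin_2pi_shift.
  by rewrite subr0 invr1 mul1r add0r addrK.
- exact: continuous_subspaceT.
- split.
  + by move=> x _; have [] := is_derive_wave c x.
  + by apply: cvg_at_right_filter; exact: cF.
  + by apply: cvg_at_left_filter; exact: cF.
- by move=> x _; rewrite derive1E; have [] := is_derive_wave c x.
Qed.

Context {d : measure_display} {T : measurableType d} (P : probability T R).
Implicit Types (V W : {RV P >-> R}).

Lemma has_law_integral V (mu : probability (measurableTypeR R) R)
    (f : measurableTypeR R -> \bar R) :
  has_law P V mu -> measurable_fun setT f -> (forall x, 0 <= f x)%E ->
  (\int[P]_y f (V y) = \int[mu]_x f x)%E.
Proof.
move=> lawV mf f0; pose V' : T -> measurableTypeR R := V.
have mV : measurable_fun setT V' by exact: (measurable_funPT V).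
rewrite -[LHS](@ge0_integral_pushforward _ _ _ _ _ V' mV P setT f)//.
by apply: eq_measure_integral => A mA _; exact: lawV.
Qed.

(** The law of (V, W) agrees with the product measure on rectangles, hence
    everywhere, and the integral splits by Tonelli. *)
Lemma joint_law_integral V W (mu : probability (measurableTypeR R) R)
    (f g : measurableTypeR R -> \bar R) :
  has_law P V mu -> has_law P W mu ->
  (forall A B, measurable A -> measurable B ->
     P (V @^-1` A `&` W @^-1` B) = P (V @^-1` A) * P (W @^-1` B))%E ->
  measurable_fun setT f -> measurable_fun setT g ->
  (forall x, 0 <= f x)%E -> (forall x, 0 <= g x)%E ->
  (\int[P]_y (f (V y) * g (W y)) = (\int[mu]_x f x) * \int[mu]_x g x)%E.
Proof.
move=> lawV lawW ind mf mg f0 g0.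
pose h (z : measurableTypeR R * measurableTypeR R) := (f z.1 * g z.2)%E.
have mh : measurable_fun setT h by apply: emeasurable_funM; exact: measurableT_comp.
have h0 z : (0 <= h z)%E by exact: mule_ge0.
pose VW y : measurableTypeR R * measurableTypeR R := (V y, W y).
have mVW : measurable_fun setT VW.
  apply/measurable_fun_pairP; split; first exact: (measurable_funPT V).
  exact: (measurable_funPT W).
transitivity (\int[(mu \x mu)%E]_z h z)%E.
  rewrite -[LHS](@ge0_integral_pushforward _ _ _ _ _ VW mVW P setT h)//.
  apply: eq_measure_integral => A mA _; symmetry.
  apply: product_measure_unique => // B C mB mC.
  by have := ind _ _ mB mC; rewrite (lawV _ mB) (lawW _ mC) => <-.
rewrite fubini_tonelli1// /fubini_F/= -ge0_integralZr//; last exact: integral_ge0.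
by apply: eq_integral => x _; rewrite /h/= ge0_integralZl.
Qed.

Definition bounded_rv (f : T -> R) := measurable_fun setT f /\
  exists M : R, forall y, `|f y| <= M.

Lemma bounded_rv_integrable f : bounded_rv f -> P.-integrable setT (EFin \o f).
Proof.
move=> [mf [M fM]]; apply: measurable_bounded_integrable => //.
  by rewrite ltey_eq fin_num_measure.
exists M; split => [|N MN y _]; first exact: num_real.
exact: le_trans (fM y) (ltW MN).
Qed.

Lemma bounded_rvD f g : bounded_rv f -> bounded_rv g ->
  bounded_rv (fun y => f y + g y).
Proof.
move=> [mf [M fM]] [mg [N gN]]; split; first exact: measurable_funD.
by exists (M + N) => y; rewrite (le_trans (ler_normD _ _))// lerD.
Qed.

Lemma bounded_rvM f g : bounded_rv f -> bounded_rv g ->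
  bounded_rv (fun y => f y * g y).
Proof.
move=> [mf [M fM]] [mg [N gN]]; split; first exact: measurable_funM.
by exists (M * N) => y; rewrite normrM ler_pM.
Qed.

Lemma bounded_rv_cst c : bounded_rv (fun=> c).
Proof. by split; [exact: measurable_cst|exists `|c|]. Qed.

Lemma bounded_rvZ c f : bounded_rv f -> bounded_rv (fun y => c * f y).
Proof. by apply: bounded_rvM; exact: bounded_rv_cst. Qed.

Lemma bounded_rv_sum (s : seq nat) (f : nat -> T -> R) :
  (forall i, bounded_rv (f i)) -> bounded_rv (fun y => \sum_(i <- s) f i y).
Proof.
move=> bf; elim: s => [|i s IH].
  by under eq_fun do rewrite big_nil; exact: bounded_rv_cst.
by under eq_fun do rewrite big_cons; exact: bounded_rvD.
Qed.


Lemma meanD f g : bounded_rv f -> bounded_rv g ->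
  \int[P]_y (f y + g y) = \int[P]_y f y + \int[P]_y g y.
Proof. by move=> bf bg; rewrite RintegralD//; exact: bounded_rv_integrable. Qed.

Lemma meanZ c f : bounded_rv f -> \int[P]_y (c * f y) = c * \int[P]_y f y.
Proof. by move=> bf; rewrite RintegralZl//; exact: bounded_rv_integrable. Qed.

Lemma mean_cst c : \int[P]_y c = c.
Proof.
rewrite Rintegral_cst// -[RHS]mulr1; congr (_ * _).
exact: (congr1 fine (probability_setT P)).
Qed.

Lemma bounded_rv_wave c V : bounded_rv (fun y => wave c (V y)).
Proof.
split; last by exists 1 => y; exact: wave_le.
by apply: measurableT_comp => //; exact: measurable_wave.
Qed.

Lemma mean_wave c V : has_law P V unif -> \int[P]_y wave c (V y) = 0.
Proof.
move=> lawV; have bw := bounded_rv_wave c V.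
have : \int[P]_y (1 + wave c (V y)) = 1.
  rewrite /Rintegral.
  rewrite (@has_law_integral V unif (fun x => (1 + wave c x)%:E))// ?integral_wave//.
  - apply/measurable_EFinP; apply: measurable_funD; first exact: measurable_cst.
    exact: measurable_wave.
  - by move=> x; rewrite lee_fin wave_ge.
by rewrite (meanD (bounded_rv_cst 1) bw) mean_cst; lra.
Qed.

(** Tonelli is used for the nonnegative functions 1 + wave, whose means are 1; the
    product of two waves is recovered by expanding. *)
Lemma mean_waveM c c' V W : has_law P V unif -> has_law P W unif ->
  (forall A B, measurable A -> measurable B ->
     P (V @^-1` A `&` W @^-1` B) = P (V @^-1` A) * P (W @^-1` B))%E ->
  \int[P]_y (wave c (V y) * wave c' (W y)) = 0.
Proof.
move=> lawV lawW ind; have bV := bounded_rv_wave c V; have bW := bounded_rv_wave c' W.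
have mw b : measurable_fun [set: R] (fun x => (1 + wave b x)%:E).
  apply/measurable_EFinP; apply: measurable_funD; first exact: measurable_cst.
  exact: measurable_wave.
have w0 b x : (0 <= (1 + wave b x)%:E)%E by rewrite lee_fin wave_ge.
have H : \int[P]_y ((1 + wave c (V y)) * (1 + wave c' (W y))) = 1.
  rewrite /Rintegral; under eq_integral do rewrite EFinM.
  rewrite (@joint_law_integral V W unif (fun x => (1 + wave c x)%:E)
    (fun x => (1 + wave c' x)%:E))//; [|exact: (mw c)|exact: (mw c')].
  by rewrite !integral_wave mule1.
have E y : wave c (V y) * wave c' (W y) = (1 + wave c (V y)) * (1 + wave c' (W y)) +
   (-1 + (-1 * wave c (V y) + -1 * wave c' (W y))) by ring.
have b1 := bounded_rv_cst 1.
have bV' := bounded_rvZ (-1) bV; have bW' := bounded_rvZ (-1) bW.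
under eq_Rintegral do rewrite E.
rewrite meanD; last 2 first.
- by apply: bounded_rvM; exact: bounded_rvD.
- by apply: bounded_rvD (bounded_rv_cst (-1)) _; exact: bounded_rvD.
rewrite H meanD; [|exact: bounded_rv_cst|exact: bounded_rvD].
by rewrite meanD// !meanZ// !mean_wave// mean_cst; ring.
Qed.

End RandomPhase.

(** * Dyadic chaining for partial sums *)

Section Chaining.
Context {R : realType}.
Implicit Types (x : nat -> R) (b t : R) (m s r n : nat).

(** A bound for the squares of all sums over initial parts of [s, s + 2^m).  A sum
    reaching into the right half is the full left half plus an initial part of the
    right half, and (u + v)^2 <= b v^2 + b / (b - 1) u^2; the parameter b > 1
    trades a geometric loss per level for a bound without factors of m. *)
Fixpoint chain b x m s : R :=
  if m is m'.+1 then
    b * (chain b x m' s + chain b x m' (s + 2 ^ m')) +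
    b / (b - 1) * (\sum_(s <= i < s + 2 ^ m') x i) ^+ 2
  else x s ^+ 2.

Lemma chain_ge0 b x m s : 1 < b -> 0 <= chain b x m s.
Proof.
move=> b1; elim: m s => [|m IH] s /=; first exact: sqr_ge0.
have b0 : 0 <= b by lra.
by rewrite addr_ge0// mulr_ge0 ?sqr_ge0 ?addr_ge0// divr_ge0// subr_ge0 ltW.
Qed.

Lemma sqrD_le b (u v : R) : 1 < b ->
  (u + v) ^+ 2 <= b * v ^+ 2 + b / (b - 1) * u ^+ 2.
Proof.
move=> b1; have b10 : 0 < b - 1 by rewrite subr_gt0.
rewrite -subr_ge0 (_ : _ - _ = (u - (b - 1) * v) ^+ 2 / (b - 1)).
  by rewrite divr_ge0 ?sqr_ge0 ?ltW.
by field; rewrite gt_eqF.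
Qed.

Lemma chain_max b x m s r : 1 < b -> (r <= 2 ^ m)%N ->
  (\sum_(s <= i < s + r) x i) ^+ 2 <= chain b x m s.
Proof.
move=> b1; have b0 : 0 <= b by lra.
have bb : 0 <= b / (b - 1) by rewrite divr_ge0// subr_ge0 ltW.
elim: m s r => [|m IH] s r; first rewrite expn0.
  case: r => [|[|//]] _; last by rewrite addn1 big_nat1.
  by rewrite addn0 big_geq// expr0n sqr_ge0.
have C1 := chain_ge0 x m s b1; have C2 := chain_ge0 x m (s + 2 ^ m) b1.
move=> rm /=; have [rm'|/ltnW rm'] := leqP r (2 ^ m).
  rewrite (le_trans (IH s _ rm'))// -[leLHS]addr0 lerD//.
    by move: C1 C2; move: (chain _ _ _ _) (chain _ _ _ _) => u v; nra.
  exact: mulr_ge0 bb (sqr_ge0 _).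
rewrite (big_cat_nat (n := s + 2 ^ m)) ?leq_addr ?leq_add2l//=.
rewrite (le_trans (sqrD_le _ _ b1))// lerD2r ler_wpM2l//.
rewrite -(subnKC rm') addnA (le_trans (IH _ _ _)) ?lerDr//.
by rewrite leq_subLR addnn -mul2n -expnS.
Qed.

Section Oscillation.
Variables (x : nat -> R) (t B : R).
Hypotheses (t0 : 0 < t) (t1 : t < 1) (B0 : 0 <= B).
Hypothesis chainB : forall m, chain t^-1 x m (2 ^ m) <= B * t ^+ m ^+ 2.

Let tinv1 : 1 < t^-1. Proof. by rewrite invf_gt1. Qed.

Lemma dyadic_block m r : (r <= 2 ^ m)%N ->
  `|\sum_(2 ^ m <= i < 2 ^ m + r) x i| <= Num.sqrt B * t ^+ m.
Proof.
move=> rm; have tm : 0 <= t ^+ m by rewrite exprn_ge0// ltW.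
rewrite -(ler_pXn2r (n := 2)) ?nnegrE ?mulr_ge0 ?sqrtr_ge0//.
rewrite real_normK ?num_real// exprMn sqr_sqrtr//.
exact: le_trans (chain_max _ _ tinv1 rm) (chainB m).
Qed.

(** The sum is cut at the successive powers of 2, and each piece is bounded by
    [dyadic_block]. *)
Lemma dyadic_tail m d n : (2 ^ m <= n)%N -> (n <= 2 ^ (m + d))%N ->
  `|\sum_(2 ^ m <= i < n) x i| <= Num.sqrt B * t ^+ m * \sum_(0 <= i < d) t ^+ i.
Proof.
have sB := sqrtr_ge0 B; have tm j : 0 <= t ^+ j by rewrite exprn_ge0// ltW.
elim: d m => [|d IH] m mn nm.
  rewrite addn0 in nm; have -> : n = (2 ^ m)%N by apply/eqP; rewrite eqn_leq nm.
  by rewrite !big_geq// normr0 mulr0.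
rewrite big_nat_recl// expr0 mulrDr mulr1.
have [n2|/ltnW n2] := leqP n (2 ^ m.+1).
  rewrite -(subnKC mn) (le_trans (dyadic_block _))//.
    by rewrite leq_subLR addnn -mul2n -expnS.
  by rewrite lerDl !mulr_ge0// sumr_ge0.
rewrite (big_cat_nat (n := 2 ^ m.+1)) ?leq_exp2l//=.
rewrite (le_trans (ler_normD _ _))// lerD//.
  have -> : (2 ^ m.+1 = 2 ^ m + 2 ^ m)%N by rewrite addnn -mul2n -expnS.
  exact: dyadic_block.
rewrite (le_trans (IH _ n2 _)) ?addSnnS//.
rewrite exprSr mulrA -!mulrA !ler_wpM2l// mulr_sumr.
by apply: ler_sum => i _; rewrite exprS.
Qed.

Let C := Num.sqrt B / (1 - t).

Lemma dyadic_tail_le m n : (2 ^ m <= n)%N ->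
  `|\sum_(2 ^ m <= i < n) x i| <= C * t ^+ m.
Proof.
move=> mn; rewrite (le_trans (@dyadic_tail m n n mn _))//.
  by rewrite ltnW// (leq_trans (ltn_expl n (ltnSn 1)))// leq_exp2l// leq_addl.
rewrite /C [leRHS]mulrAC ler_wpM2l ?mulr_ge0 ?sqrtr_ge0 ?exprn_ge0 ?(ltW t0)//.
have := geometric_seriesE 1 (negbT (lt_eqF t1)) => /(congr1 (fun f => f n)).
rewrite /series /geometric/=; under eq_bigr do rewrite mul1r.
move=> ->; rewrite mul1r ler_pdivrMr ?subr_gt0// mulVf ?gt_eqF ?subr_gt0//.
by rewrite gerBl exprn_ge0// ltW.
Qed.

Lemma dyadic_cvg : cvgn (series x).
Proof.
apply/cauchy_cvgP/cauchy_seriesP => e e0.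
have [m Hm] : exists m, 2 * C * t ^+ m < e.
  have : 2 * C * t ^+ m @[m --> \oo] --> (0 : R).
    have := @cvg_geometric _ (2 * C) t; rewrite /geometric/=; apply.
    by rewrite ger0_norm// ltW.
  move=> /cvgrPdist_lt/(_ _ e0)[m _ /(_ m (leqnn m))]; rewrite sub0r normrN => h.
  by exists m; exact: le_lt_trans (ler_norm _) h.
exists ([set n | (2 ^ m <= n)%N], [set n | (2 ^ m <= n)%N]) => /=.
  by split; exists (2 ^ m)%N.
move=> [n1 n2] /= [m1 m2]; apply: le_lt_trans Hm.
have C0 : 0 <= C * t ^+ m by exact: le_trans (normr_ge0 _) (dyadic_tail_le m1).
have [n12|n21] := leqP n1 n2; last first.
  by rewrite big_geq ?(ltnW n21)// normr0 -mulrA mulr_ge0.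
have -> : \sum_(n1 <= k < n2) x k =
    \sum_(2 ^ m <= i < n2) x i - \sum_(2 ^ m <= i < n1) x i.
  by apply/eqP; rewrite eq_sym subr_eq addrC -(big_cat_nat m1 n12).
rewrite (le_trans (ler_normB _ _))// -mulrA [leRHS]mulr_natl mulr2n.
by rewrite lerD// dyadic_tail_le.
Qed.

Lemma dyadic_lim : limn (series x) ^+ 2 <= 2 * x 0%N ^+ 2 + 2 * (B / (1 - t) ^+ 2).
Proof.
have CB : C ^+ 2 = B / (1 - t) ^+ 2 by rewrite /C expr_div_n sqr_sqrtr.
have H : `|limn (series x)| <= `|x 0%N| + C.
  rewrite -(cvg_lim _ (cvg_norm dyadic_cvg))//; apply: limr_le.
    by apply: is_cvg_norm; exact: dyadic_cvg.
  near=> n; rewrite /series/= big_ltn; last by near: n; exact: nbhs_infty_gt.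
  rewrite (le_trans (ler_normD _ _))// lerD2l.
  have := @dyadic_tail_le 0 n; rewrite expn0 expr0 mulr1; apply.
  by near: n; exact: nbhs_infty_ge.
rewrite -CB; move: H; move: (limn (series x)) (x 0%N) => l y H.
rewrite -(real_normK (num_real l)) -(real_normK (num_real y)).
apply: (@le_trans _ _ ((`|y| + C) ^+ 2)).
  by rewrite lerXn2r ?nnegrE// (le_trans (normr_ge0 l)).
by have := sqr_ge0 (`|y| - C); nra.
Unshelve. all: by end_near. Qed.

End Oscillation.
End Chaining.

(** * Decay of the amplitudes *)

Section Amplitudes.
Context {R : realType}.

(** Eventually Gamma_j >= j / 2, so block m contributes at most
    2^m (2^m / 2)^(-2/alpha), which is a multiple of (2^(1 - 2/alpha))^m; the ratio
    is below 1 because alpha < 2, and t is its fourth root.  The finitely many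
    exceptional blocks are absorbed into D. *)
Lemma amplitude_blocks (alpha : R) (Gam : nat -> R) : 0 < alpha -> alpha < 2 ->
  (forall j, 0 < Gam j) -> Gam j / j%:R @[j --> \oo] --> (1 : R) ->
  exists t D : R, [/\ 0 < t, t < 1, 0 <= D &
    forall m, \sum_(2 ^ m <= i < 2 ^ m + 2 ^ m) (Gam i `^ (- alpha^-1)) ^+ 2 <=
      D * t ^+ (4 * m)].
Proof.
move=> a0 a2 G0 /cvgrPdist_lt/(_ 2^-1); rewrite invr_gt0 ltr0n => /(_ isT)[J _ HJ].
pose e : R := 2 / alpha.
have e1 : 1 < e by rewrite /e ltr_pdivlMr// mul1r.
pose t : R := 2 `^ ((1 - e) / 4).
have t0 : 0 < t by exact: powR_gt0.
have t1 : t < 1.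
  rewrite /t /powR gt_eqF// -[ltRHS]expR0 ltr_expR pmulr_llt0 ?ln_gt0 ?ltr1n//.
  by rewrite pmulr_llt0 ?invr_gt0//; lra.
have t4 m : t ^+ (4 * m) = (2 ^+ m) `^ (1 - e).
  rewrite -powR_mulrn ?powR_ge0// natrM /t -powRrM -powR_mulrn// -powRrM.
  by congr (_ `^ _); field.
pose S m := \sum_(2 ^ m <= i < 2 ^ m + 2 ^ m) (Gam i `^ (- alpha^-1)) ^+ 2.
have S0 m : 0 <= S m by apply: sumr_ge0 => i _; exact: sqr_ge0.
have tm m : 0 < t ^+ (4 * m) by exact: exprn_gt0.
have q0 m : 0 <= S m / t ^+ (4 * m) by rewrite divr_ge0// ltW.
exists t, (2 `^ e + \sum_(0 <= m < J) S m / t ^+ (4 * m)); split => //.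
  by rewrite addr_ge0 ?powR_ge0// sumr_ge0.
move=> m; rewrite -/(S m) -ler_pdivrMr//.
have [mJ|Jm] := ltnP m J.
  rewrite (bigD1_seq m) ?mem_index_iota ?iota_uniq//=.
  by rewrite addrCA lerDl addr_ge0 ?powR_ge0// sumr_ge0.
apply: (@le_trans _ _ (2 `^ e)); last by rewrite lerDl sumr_ge0.
rewrite ler_pdivrMr//.
have M0 : 0 < (2 ^+ m : R) by rewrite exprn_gt0.
apply: (@le_trans _ _ (\sum_(2 ^ m <= i < 2 ^ m + 2 ^ m) (2 ^+ m / 2) `^ (- e))).
  apply: ler_sum_nat => i /andP[mi _].
  have iJ : (J <= i)%N by rewrite (leq_trans Jm)// (leq_trans _ mi)// ltnW// ltn_expl.
  have i0 : 0 < i%:R :> R by rewrite ltr0n (leq_trans _ mi)// expn_gt0.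
  have Gi : 2 ^+ m / 2 <= Gam i.
    have := HJ i iJ; rewrite ltr_distlC => /andP[h _].
    have {h} : 2^-1 < Gam i / i%:R by apply: le_lt_trans h; lra.
    rewrite ltr_pdivlMr// => h; rewrite (le_trans _ (ltW h))// mulrC ler_wpM2l ?invr_ge0//.
    by rewrite -natrX ler_nat.
  rewrite -powR_mulrn ?powR_ge0// -powRrM.
  rewrite (_ : - alpha^-1 * 2%:R = - e); last by rewrite /e mulNr mulrC.
  rewrite !powRN lef_pV2 ?posrE ?powR_gt0 ?divr_gt0//.
  have e0 : 0 <= e by exact: le_trans ler01 (ltW e1).
  by apply: ge0_ler_powR => //; rewrite nnegrE ?divr_ge0 ?(ltW M0) ?(ltW (G0 i)).
rewrite big_const_nat iter_addr_0 addnK -[leLHS]mulr_natl natrX t4.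
rewrite powRM ?invr_ge0 ?(ltW M0)//.
rewrite powRD; last by apply/implyP => _; rewrite gt_eqF.
have -> : 2^-1 `^ (- e) = 2 `^ e :> R.
  by rewrite -(@powR_inv1 _ 2)// -powRrM mulN1r opprK.
by rewrite (powRr1 (ltW M0)) mulrA mulrC.
Qed.
End Amplitudes.

(** * Mean energy of a random series *)

Section Energy.
Context {R : realType} {d : measure_display} {T : measurableType d}.
Variables (P : probability T R) (U : nat -> {RV P >-> R}).
Hypothesis iidU : iid_with_law P U (uniform_prob (@ltr01 R)).
Implicit Types (a c : nat -> R).

Lemma iid_pairwise i j (A B : set R) : i != j -> measurable A -> measurable B ->
  (P (U i @^-1` A `&` U j @^-1` B) = P (U i @^-1` A) * P (U j @^-1` B))%E.
Proof.
move=> ij mA mB; have [ind _] := iidU.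
pose C k := if k == i then A else B.
have mC k : measurable (C k) by rewrite /C; case: ifP.
have us : uniq [:: i; j] by rewrite /= inE ij.
have := ind [:: i; j] C us mC.
rewrite bigcap_seq !big_cons !big_nil /C eqxx [j == i]eq_sym (negbTE ij) setIT mulr1 => ->.
have mU k (D : set R) : measurable D -> measurable (U k @^-1` D).
  by move=> mD; rewrite -[X in measurable X]setTI; exact: (measurable_funPT (U k)).
by rewrite EFinM !fineK//; apply: fin_num_measure; exact: mU.
Qed.

Definition phase a c i y : R := a i * wave (c i) (U i y).

Lemma bounded_rv_phase a c i : bounded_rv (phase a c i).
Proof. by apply: bounded_rvZ; exact: bounded_rv_wave. Qed.

Lemma mean_sqr_sum a c (s : seq nat) : uniq s ->
  \int[P]_y (\sum_(i <- s) phase a c i y) ^+ 2 <= \sum_(i <- s) a i ^+ 2.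
Proof.
have lawU i : has_law P (U i) (uniform_prob (@ltr01 R)) by have [_] := iidU.
have bw i : bounded_rv (fun y => wave (c i) (U i y)) by exact: bounded_rv_wave.
elim: s => [_|i s IH /= /andP[is_ us]].
  under eq_Rintegral do rewrite big_nil expr0n.
  by rewrite big_nil mean_cst.
have bS : bounded_rv (fun y => \sum_(j <- s) phase a c j y).
  by apply: bounded_rv_sum => j; exact: bounded_rv_phase.
have bS2 : bounded_rv (fun y => (\sum_(j <- s) phase a c j y) ^+ 2).
  by under eq_fun do rewrite expr2; exact: bounded_rvM.
have bW2 : bounded_rv (fun y => wave (c i) (U i y) ^+ 2).
  by under eq_fun do rewrite expr2; exact: bounded_rvM.
have bterm j : bounded_rv (fun y => (2 * a i * a j) *
    (wave (c i) (U i y) * wave (c j) (U j y))).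
  by apply: bounded_rvZ; exact: bounded_rvM.
have cross : \int[P]_y (\sum_(j <- s) (2 * a i * a j) *
    (wave (c i) (U i y) * wave (c j) (U j y))) = 0.
  elim: s is_ {IH us bS bS2} => [_|j s IH].
    by under eq_Rintegral do rewrite big_nil; rewrite mean_cst.
  rewrite inE negb_or => /andP[ij is_].
  under eq_Rintegral do rewrite big_cons.
  rewrite meanD; [|exact: bterm|by apply: bounded_rv_sum => k; exact: bterm].
  rewrite IH// addr0 meanZ; last exact: bounded_rvM.
  by rewrite mean_waveM ?mulr0// => A B mA mB; exact: iid_pairwise.
have E y : (\sum_(j <- i :: s) phase a c j y) ^+ 2 = a i ^+ 2 * wave (c i) (U i y) ^+ 2 +
   (\sum_(j <- s) (2 * a i * a j) * (wave (c i) (U i y) * wave (c j) (U j y)) +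
   (\sum_(j <- s) phase a c j y) ^+ 2).
  rewrite big_cons sqrrD exprMn -addrA; congr (_ + (_ + _)).
  rewrite -mulr_natl mulrA mulr_sumr; apply: eq_bigr => j _.
  by rewrite /phase; ring.
under eq_Rintegral do rewrite E.
have bC : bounded_rv (fun y => \sum_(j <- s) (2 * a i * a j) *
    (wave (c i) (U i y) * wave (c j) (U j y))) by exact: bounded_rv_sum.
rewrite meanD; [|exact: bounded_rvZ|exact: bounded_rvD].
rewrite meanD// cross add0r big_cons lerD ?IH// meanZ//.
rewrite ler_piMr ?sqr_ge0// -[leRHS](mean_cst P 1).
apply: le_Rintegral => //; try exact: bounded_rv_integrable.
  by apply: bounded_rv_integrable; exact: bounded_rv_cst.
move=> y _; rewrite -[_ ^+ 2]ger0_norm ?sqr_ge0// normrX.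
by rewrite exprn_ile1// wave_le.
Qed.

Lemma bounded_rv_chain b a c m s : bounded_rv (fun y => chain b (phase a c ^~ y) m s).
Proof.
have bsum (r : seq nat) : bounded_rv (fun y => (\sum_(i <- r) phase a c i y) ^+ 2).
  under eq_fun do rewrite expr2.
  by apply: bounded_rvM; apply: bounded_rv_sum => i; exact: bounded_rv_phase.
elim: m s => [|m IH] s /=.
  under eq_fun do rewrite expr2.
  by apply: bounded_rvM; exact: bounded_rv_phase.
apply: bounded_rvD; apply: bounded_rvZ; last exact: bsum.
exact: bounded_rvD.
Qed.

(** By orthogonality the squared left half costs at most its share of the sum of
    a_i^2.  The coefficient is the solution K_m of K_(m+1) = b K_m + b / (b - 1),
    K_0 = 1. *)
Lemma mean_chain b a c m s : 1 < b ->
  \int[P]_y chain b (phase a c ^~ y) m s <=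
  ((1 + b / (b - 1) ^+ 2) * b ^+ m - b / (b - 1) ^+ 2) *
    \sum_(s <= i < s + 2 ^ m) a i ^+ 2.
Proof.
move=> b1; have b10 : 0 < b - 1 by rewrite subr_gt0.
have bc := bounded_rv_chain b a c.
have bsum (r : seq nat) : bounded_rv (fun y => (\sum_(i <- r) phase a c i y) ^+ 2).
  under eq_fun do rewrite expr2.
  by apply: bounded_rvM; apply: bounded_rv_sum => i; exact: bounded_rv_phase.
set L := b / _; have LE : L * (b - 1) = b / (b - 1) by rewrite /L; field; rewrite gt_eqF.
have L0 : 0 <= L by rewrite divr_ge0 ?sqr_ge0//; lra.
elim: m s => [|m IH] s.
  have := @mean_sqr_sum a c [:: s] isT; rewrite big_seq1.
  under eq_Rintegral do rewrite big_seq1.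
  by move=> h; rewrite expn0 addn1 big_nat1 expr0 mulr1 addrK mul1r.
rewrite /= meanD; last 2 first.
- by apply: bounded_rvZ; exact: bounded_rvD.
- exact: bounded_rvZ.
rewrite meanZ; last exact: bounded_rvD.
rewrite meanD// meanZ//.
have -> : (s + 2 ^ m.+1 = s + 2 ^ m + 2 ^ m)%N by rewrite expnS mul2n -addnn addnA.
rewrite (big_cat_nat (n := s + 2 ^ m)) ?leq_addr//=.
have H1 := IH s; have H2 := IH (s + 2 ^ m)%N.
have H3 := @mean_sqr_sum a c (index_iota s (s + 2 ^ m)) (iota_uniq _ _).
have S1 : 0 <= \sum_(s <= i < s + 2 ^ m) a i ^+ 2 by apply: sumr_ge0 => i _; exact: sqr_ge0.
have S2 : 0 <= \sum_(s + 2 ^ m <= i < s + 2 ^ m + 2 ^ m) a i ^+ 2.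
  by apply: sumr_ge0 => i _; exact: sqr_ge0.
move: H1 H2 H3 S1 S2.
move: (\sum_(s <= i < s + 2 ^ m) a i ^+ 2) => s1.
move: (\sum_(s + 2 ^ m <= i < s + 2 ^ m + 2 ^ m) a i ^+ 2) => s2.
move: (\int[P]_y _) (\int[P]_y _) (\int[P]_y _) => i1 i2 i3 H1 H2 H3 S1 S2.
rewrite -LE exprS; move: (b ^+ m) H1 H2 => bm H1 H2.
apply: (@le_trans _ _ (b * (((1 + L) * bm - L) * s1 + ((1 + L) * bm - L) * s2) + L * (b - 1) * s1)).
  rewrite lerD//.
    by rewrite ler_wpM2l ?lerD//; lra.
  by rewrite ler_wpM2l// mulr_ge0// ltW.
have h : 0 <= L * (b - 1) * s2 by exact: mulr_ge0 (mulr_ge0 L0 (ltW b10)) S2.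
rewrite -subr_ge0 (_ : _ - _ = L * (b - 1) * s2)//; by ring.
Qed.

(** With b = 1/t the chain of block m has mean at most of order t^(-m) t^(4m); the weight
    t^(-2m) leaves a convergent series while still forcing the chains, hence the
    block oscillations, to decay geometrically. *)
Definition energy t a c y : \bar R :=
  (\sum_(0 <= m <oo) (t ^- (2 * m) * chain t^-1 (phase a c ^~ y) m (2 ^ m))%:E)%E.

Section EnergyBound.
Variables (t D : R) (a c : nat -> R).
Hypotheses (t0 : 0 < t) (t1 : t < 1) (D0 : 0 <= D).
Hypothesis blocks : forall m,
  \sum_(2 ^ m <= i < 2 ^ m + 2 ^ m) a i ^+ 2 <= D * t ^+ (4 * m).

Let tinv1 : 1 < t^-1. Proof. by rewrite invf_gt1. Qed.

Lemma energy_term_ge0 m y :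
  (0 <= (t ^- (2 * m) * chain t^-1 (phase a c ^~ y) m (2 ^ m))%:E)%E.
Proof.
by rewrite lee_fin mulr_ge0 ?chain_ge0// invr_ge0 exprn_ge0// ltW.
Qed.

Lemma energy_ge0 y : (0 <= energy t a c y)%E.
Proof. by apply: nneseries_ge0 => m _ _; exact: energy_term_ge0. Qed.

Lemma measurable_energy_term m : measurable_fun setT
  (fun y => (t ^- (2 * m) * chain t^-1 (phase a c ^~ y) m (2 ^ m))%:E).
Proof.
apply/measurable_EFinP; have [] // := @bounded_rvZ _ _ _ (t ^- (2 * m)) _
  (bounded_rv_chain t^-1 a c m (2 ^ m)).
Qed.

Lemma measurable_energy : measurable_fun setT (energy t a c).
Proof.
apply: (@ge0_emeasurable_sum _ _ _ _ _ xpredT) => [m y _ _|m _].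
  exact: energy_term_ge0.
exact: measurable_energy_term.
Qed.

Lemma integral_energy :
  (\int[P]_y energy t a c y <= ((1 + t^-1 / (t^-1 - 1) ^+ 2) * D / (1 - t))%:E)%E.
Proof.
set K := 1 + _.
have K0 : 0 <= K by rewrite /K addr_ge0// divr_ge0 ?sqr_ge0// invr_ge0 ltW.
rewrite integral_nneseries//; last 2 first.
- exact: measurable_energy_term.
- by move=> m y _; exact: energy_term_ge0.
have tn m : 0 < t ^+ m by rewrite exprn_gt0.
have term m : (\int[P]_y (t ^- (2 * m) * chain t^-1 (phase a c ^~ y) m (2 ^ m))%:E <=
    (K * D * t ^+ m)%:E)%E.
  have bc := @bounded_rvZ _ _ _ (t ^- (2 * m)) _ (bounded_rv_chain t^-1 a c m (2 ^ m)).
  have int := integrable_fin_num measurableT (bounded_rv_integrable P bc).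
  rewrite -[leLHS]fineK// lee_fin -/(Rintegral P setT _) meanZ; last exact: bounded_rv_chain.
  rewrite ler_pdivrMl//.
  rewrite (le_trans (mean_chain a c m (2 ^ m) tinv1))//.
  have S0 : 0 <= \sum_(2 ^ m <= i < 2 ^ m + 2 ^ m) a i ^+ 2.
    by apply: sumr_ge0 => i _; exact: sqr_ge0.
  have tinvn : 0 <= t^-1 ^+ m by rewrite exprVn invr_ge0 ltW.
  apply: (@le_trans _ _ (K * t^-1 ^+ m * (D * t ^+ (4 * m)))).
    apply: (@le_trans _ _ (K * t^-1 ^+ m * \sum_(2 ^ m <= i < 2 ^ m + 2 ^ m) a i ^+ 2)).
      rewrite ler_wpM2r// gerBl divr_ge0 ?sqr_ge0// invr_ge0 ltW//.
    by rewrite ler_wpM2l// mulr_ge0.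
  rewrite exprVn le_eqVlt; apply/orP; left; apply/eqP.
  rewrite (_ : 4 * m = 2 * m + m + m)%N; last by rewrite !mulSn !addn0 !addnA.
  rewrite !exprD; move: (t ^+ m) (tn m) => u u0.
  by field; rewrite gt_eqF.
apply: (@le_trans _ _ (\sum_(0 <= m <oo) (K * D * t ^+ m)%:E)%E).
  apply: lee_nneseries => [m _ _|m _]; last exact: term.
  by apply: integral_ge0 => y _; exact: energy_term_ge0.
apply: lime_le.
  by apply: is_cvg_nneseries => m _ _; rewrite lee_fin !mulr_ge0// ltW.
near=> n; rewrite sumEFin lee_fin -mulr_sumr ler_wpM2l ?mulr_ge0//.
have := geometric_seriesE 1 (negbT (lt_eqF t1)) => /(congr1 (fun f => f n)).
rewrite /series /geometric/=; under eq_bigr do rewrite mul1r.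
move=> ->; rewrite mul1r ler_pdivrMr ?subr_gt0// mulVf ?gt_eqF ?subr_gt0//.
by rewrite gerBl ltW.
Unshelve. all: by end_near. Qed.

End EnergyBound.
End Energy.

(** * Almost sure bounds and the theorem *)

Section AlmostSure.
Context {R : realType} {d : measure_display} {T : measurableType d}.
Variable (P : probability T R).

(** By Fatou's lemma the lower limit of f has a finite mean, so it is almost surely
    finite, and any larger constant bounds f_n for infinitely many n. *)
Lemma ae_frequently_bounded (f : nat -> T -> \bar R) (M : R) :
  (forall n, measurable_fun setT (f n)) -> (forall n y, 0 <= f n y)%E ->
  (forall n, \int[P]_y f n y <= M%:E)%E ->
  {ae P, forall y, exists C : R, forall n0, exists2 n, (n0 <= n)%N & (f n y <= C%:E)%E}.
Proof.
move=> mf f0 fM; pose g y := limn_einf (f ^~ y).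
have mg : measurable_fun setT g.
  rewrite (_ : g = fun y => - limn_esup (fun n => - f n y))%E; last first.
    by apply/funext => y; rewrite -[X in limn_esup X]/(-%E \o f^~ y) limn_esupN oppeK.
  apply: measurableT_comp => //.
  apply: (@measurable_fun_limn_esup _ _ _ _ (fun n y => - f n y)%E) => n.
  exact: measurableT_comp.
have einfs_le y n : (einfs (f ^~ y) n <= g y)%E.
  rewrite /g limn_einf_lim (cvg_lim _ (@cvg_einfs_sup _ (f^~ y)))//.
  by apply: ereal_sup_ubound; exists n.
have g0 y : (0 <= g y)%E.
  apply: le_trans (einfs_le y 0%N); apply: le_ereal_inf_tmp => _ [n _ <-]; exact: f0.
have intg : (\int[P]_y g y <= M%:E)%E.
  rewrite (le_trans (fatou P measurableT mf (fun n y _ => f0 n y)))//.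
  rewrite limn_einf_lim; apply: lime_le; first exact: is_cvg_einfs.
  near=> n; apply: le_trans (fM n); apply: ereal_inf_lbound.
  by exists n => //=.
have ig : P.-integrable setT g.
  apply/integrableP; split => //.
  under eq_integral do rewrite gee0_abs//.
  by rewrite (le_lt_trans intg)// ltry.
apply: filterS (integrable_ae measurableT ig) => y /(_ Logic.I) gfin.
exists (fine (g y) + 1) => n0.
have : (einfs (f ^~ y) n0 < (fine (g y) + 1)%:E)%E.
  by rewrite (le_lt_trans (einfs_le y n0))// EFinD fineK// lteDl// lte01.
move=> /ereal_inf_lt[_ [n /= nn0 <-] h]; exists n => //; exact: ltW.
Unshelve. all: by end_near. Qed.

Variable U : nat -> {RV P >-> R}.
Hypothesis iidU : iid_with_law P U (uniform_prob (@ltr01 R)).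
Variables (t D : R) (a : nat -> R).
Hypotheses (t0 : 0 < t) (t1 : t < 1) (D0 : 0 <= D).
Hypothesis blocks : forall m,
  \sum_(2 ^ m <= i < 2 ^ m + 2 ^ m) a i ^+ 2 <= D * t ^+ (4 * m).

(** An upper bound for the square of twice the sum of the series ([majorant_cvg]),
    with a mean bounded independently of the phases c. *)
Definition majorant (c : nat -> R) y : \bar R :=
  ((8 * a 0%N ^+ 2)%:E + (8 / (1 - t) ^+ 2)%:E * energy U t a c y)%E.

Let q0 : 0 <= 8 / (1 - t) ^+ 2. Proof. by rewrite divr_ge0 ?sqr_ge0. Qed.
Let a00 : 0 <= 8 * a 0%N ^+ 2. Proof. by rewrite mulr_ge0 ?sqr_ge0. Qed.

Lemma majorant_ge0 c y : (0 <= majorant c y)%E.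
Proof. by rewrite adde_ge0 ?mule_ge0 ?lee_fin// energy_ge0. Qed.

Lemma measurable_majorant c : measurable_fun setT (majorant c).
Proof.
apply: emeasurable_funD; first exact: measurable_cst.
by apply: measurable_funeM; exact: measurable_energy.
Qed.

Let M := 8 * a 0%N ^+ 2 + 8 / (1 - t) ^+ 2 * ((1 + t^-1 / (t^-1 - 1) ^+ 2) * D / (1 - t)).

Lemma integral_majorant c : (\int[P]_y majorant c y <= M%:E)%E.
Proof.
have me := measurable_energy U a c t0 t1; have e0 := energy_ge0 U a c t0 t1.
rewrite ge0_integralD//; last 2 first.
- by move=> y _; rewrite mule_ge0 ?lee_fin.
- exact: measurable_funeM.
rewrite ge0_integralZl//.
rewrite integral_cst// [X in (_ * X + _)%E](_ : _ = 1%E); last exact: probability_setT.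
rewrite mule1.
by rewrite /M EFinD leeD2l// [leRHS]EFinM lee_wpmul2l ?lee_fin// integral_energy.
Qed.

Lemma majorant_cvg c y : (majorant c y < +oo)%E ->
  cvgn (series (phase U a c ^~ y)) /\
  (((2 * limn (series (phase U a c ^~ y))) ^+ 2)%:E <= majorant c y)%E.
Proof.
have q1 : 0 < 8 / (1 - t) ^+ 2 by rewrite divr_gt0// exprn_gt0// subr_gt0.
have e0 := energy_ge0 U a c t0 t1 y.
move=> Mfin; have efin : energy U t a c y \is a fin_num.
  rewrite ge0_fin_numE// ltey; apply: contraTneq Mfin => E.
  by rewrite /majorant E gt0_muley ?lte_fin// addey// ltxx.
set B := fine (energy U t a c y); have EB : energy U t a c y = B%:E by rewrite fineK.
have B0 : 0 <= B by rewrite fine_ge0.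
have chB m : chain t^-1 (phase U a c ^~ y) m (2 ^ m) <= B * t ^+ m ^+ 2.
  have tm : 0 < t ^+ (2 * m) by rewrite exprn_gt0.
  rewrite -exprM [(m * 2)%N]mulnC -ler_pdivrMr// mulrC -lee_fin -EB /energy.
  have := @nneseries_lim_ge _ (fun m => (t ^- (2 * m) * chain t^-1 (phase U a c ^~ y) m (2 ^ m))%:E)
    xpredT 0 m.+1 (fun m _ _ => energy_term_ge0 U a c t0 t1 m y).
  apply: le_trans; rewrite big_nat_recr//= leeDr// sume_ge0// => i _.
  exact: energy_term_ge0.
have cv := dyadic_cvg t0 t1 B0 chB; split => //.
have := dyadic_lim t0 t1 B0 chB; set l := limn _ => ll.
rewrite /majorant EB -EFinM -EFinD lee_fin exprMn.
have x0 : phase U a c 0 y ^+ 2 <= a 0%N ^+ 2.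
  rewrite /phase exprMn ler_piMr ?sqr_ge0//.
  by rewrite -[_ ^+ 2]ger0_norm ?sqr_ge0// normrX exprn_ile1// wave_le.
have -> : 8 / (1 - t) ^+ 2 * B = 8 * (B / (1 - t) ^+ 2) by rewrite mulrAC mulrA.
by move: ll x0; move: (B / _) (phase _ _ _ _ _ ^+ 2) => u v; lra.
Qed.

Variable c : int -> nat -> R.

Definition window N y : \bar R := (\sum_(0 <= i <oo)
  (majorant (c (Posz i)) y * (poisson_weight N (Posz i))%:E +
   majorant (c (Negz i)) y * (poisson_weight N (Negz i))%:E))%E.

Let term_ge0 N k y : (0 <= majorant (c k) y * (poisson_weight N k)%:E)%E.
Proof. by rewrite mule_ge0 ?majorant_ge0// lee_fin poisson_weight_ge0. Qed.

Let mterm N k : measurable_fun setT (fun y => majorant (c k) y * (poisson_weight N k)%:E)%E.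
Proof.
under eq_fun do rewrite muleC.
by apply: measurable_funeM; exact: measurable_majorant.
Qed.

Lemma integral_window N : (\int[P]_y window N y <= (M * 8)%:E)%E.
Proof.
have M0 : 0 <= M.
  rewrite -lee_fin (le_trans _ (integral_majorant (c 0)))//.
  by apply: integral_ge0 => y _; exact: majorant_ge0.
have H k : (\int[P]_y (majorant (c k) y * (poisson_weight N k)%:E) <=
    (M * poisson_weight N k)%:E)%E.
  rewrite ge0_integralZr//.
  - by rewrite [leRHS]EFinM lee_wpmul2r ?integral_majorant// lee_fin poisson_weight_ge0.
  - exact: measurable_majorant.
  - by move=> y _; exact: majorant_ge0.
  - by rewrite lee_fin poisson_weight_ge0.
rewrite integral_nneseries//; last 2 first.
- by move=> i; exact: emeasurable_funD.
- by move=> i y _; rewrite adde_ge0.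
apply: lime_le.
  apply: is_cvg_nneseries => i _ _; apply: integral_ge0 => y _.
  by rewrite adde_ge0.
near=> n; apply: (@le_trans _ _ (M * zseries (poisson_weight N) n)%:E).
  rewrite /zseries /series/= mulr_sumr -sumEFin; apply: lee_sum => i _.
  by rewrite ge0_integralD// mulrDr EFinD leeD.
by rewrite lee_fin ler_wpM2l// zseries_poisson_weight.
Unshelve. all: by end_near. Qed.

(** The windowed sums of the majorants have means bounded uniformly in N, because
    the Poisson weights have uniformly bounded sums. *)
Lemma ae_tame : {ae P, forall y,
  (forall k, cvgn (series (phase U a (c k) ^~ y))) /\
  tame (fun k => 2 * limn (series (phase U a (c k) ^~ y)))}.
Proof.
have mW N : measurable_fun setT (window N).
  apply: (@ge0_emeasurable_sum _ _ _ _ _ xpredT) => [i y _ _|i _].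
    by rewrite adde_ge0.
  exact: emeasurable_funD.
have W0 N y : (0 <= window N y)%E.
  by apply: nneseries_ge0 => i _ _; rewrite adde_ge0.
apply: filterS (ae_frequently_bounded mW W0 integral_window) => y [C HC].
have part N n : (\sum_(0 <= i < n)
  (majorant (c (Posz i)) y * (poisson_weight N (Posz i))%:E +
   majorant (c (Negz i)) y * (poisson_weight N (Negz i))%:E) <= window N y)%E.
  by apply: nneseries_lim_ge => i _ _; rewrite adde_ge0.
have fin k : (majorant (c k) y < +oo)%E.
  have [N _ WC] := HC 0%N; rewrite ltey; apply/eqP => E.
  have wk : (0 < (poisson_weight N k)%:E :> \bar R)%E by rewrite lte_fin poisson_weight_gt0.
  have Einf : (majorant (c k) y * (poisson_weight N k)%:E = +oo)%E by rewrite E gt0_mulye.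
  have : (+oo <= C%:E :> \bar R)%E.
    apply: le_trans WC; rewrite -Einf.
    have S0 n : (0 <= \sum_(0 <= i < n)
      (majorant (c (Posz i)) y * (poisson_weight N (Posz i))%:E +
       majorant (c (Negz i)) y * (poisson_weight N (Negz i))%:E))%E.
      by apply: sume_ge0 => i _; rewrite adde_ge0.
    case: k {E wk Einf} => i; apply: le_trans (part N i.+1); rewrite big_nat_recr//=;
      apply: le_trans (leeDr _ (S0 i)); [exact: leeDl|exact: leeDr].
  by rewrite leye_eq.
split => [k|]; first by have [] := majorant_cvg (fin k).
exists C => n0; have [N nN WC] := HC n0; exists N => // n.
rewrite -lee_fin (le_trans _ WC)// (le_trans _ (part N n))//.
rewrite /zseries /series/= -sumEFin; apply: lee_sum => i _.
have B k : (((2 * limn (series (phase U a (c k) ^~ y))) ^+ 2 * poisson_weight N k)%:E <=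
    majorant (c k) y * (poisson_weight N k)%:E)%E.
  rewrite [leLHS]EFinM lee_wpmul2r ?lee_fin ?poisson_weight_ge0//.
  by have [] := majorant_cvg (fin k).
exact: (leeD (B (Posz i)) (B (Negz i))).
Qed.

End AlmostSure.

Theorem proposition1p1 (d : measure_display) (T : measurableType d)
    (R : realType) (P : probability T R) (Gamma zeta U : nat -> {RV P >-> R})
    (model : model_hypotheses Gamma zeta U)
    (alpha : R) (alpha_gt0 : 0 < alpha) (alpha_lt2 : alpha < 2)
    (y0 : T) (omega_Omega1 : Omega1 (environment_at Gamma zeta y0)) :
  quenched_ae P U (environment_at Gamma zeta y0)
    (fun (omega : nat -> R * R) (u : nat -> R) =>
    let rho := varrho alpha omega u in
    ((forall k : int, varrho_finite alpha omega u k) /\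
     (\esum_(k in [set: int]) ((1 + k%:~R ^+ 2)^-1 * rho k ^+ 2)%:E < +oo)%E) /\
    self_adjoint (Delta_dom rho) (Delta_op rho)).
Proof.
have [[Gam0 GamS _] _ iidU _] := model.
have Gpos j : 0 < Gamma j y0.
  by elim: j => [|j IH]; [exact: Gam0|exact: lt_trans (GamS j y0)].
have [t [D [t0 t1 D0 blocks]]] :=
  amplitude_blocks alpha_gt0 alpha_lt2 Gpos omega_Omega1.
pose c (k : int) j := k%:~R * zeta j y0.
apply: filterS (ae_tame iidU t0 t1 D0 blocks c) => y [cv tm].
split; last exact: Delta_self_adjoint.
split; first exact: cv.
apply/esum_ltoo => [k|]; last exact: (tame_weighted_summable tm).
by rewrite mulr_ge0 ?sqr_ge0// invr_ge0 addr_ge0 ?sqr_ge0.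
Qed.
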